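(* Let $A=(A_1,A_2)$ be a pair of complex $n\times m$ matrices with $\ker A_1\cap\ker A_2=\{0\}$ and $\ker A_1^\dagger\cap\ker A_2^\dagger=\{0\}$, and let $g\in GL_n(\mathbb{C})$, $h\in GL_m(\mathbb{C})$ be such that $g(sA_1+A_2)h^\dagger$ is the Kronecker canonical form of the pencil $sA_1+A_2$, with regular block $sC+D$ (if present). With the notation of the context: (1) $\{(X_{\gamma_\alpha},Y_{\gamma_\alpha})\}^\theta_{\alpha=0}$ is the coarse DM-flag of $(A_1,A_2)$. (2) Suppose that $s C+D$ is an $n_0 \times n_0$ upper triangular pencil. Then the union of $\{(X_{\gamma}, Y_{\gamma})\}_{\gamma= 0}^b$ and $\{ (X_{c,\beta},Y_{c,\beta})\}_{\beta = 1}^{n_0-1}$ is a DM-flag of $(A_1,A_2)$.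
   Context: Kronecker form: for a positive integer $\epsilon$, $L_\epsilon$ is the $\epsilon\times(\epsilon+1)$ matrix with $(L_\epsilon)_{ii}=1$, $(L_\epsilon)_{i,i+1}=s$ and zeros elsewhere ($s$ an indeterminate), and $L_\eta^\dagger$ denotes the transposed $(\eta+1)\times\eta$ matrix. A pencil $sC+D$ is regular if it is square and $\det(sC+D)\neq0$ for some $s\in\mathbb{C}$. Every pencil $sA_1+A_2$ of complex $n\times m$ matrices $A_1,A_2$ with trivial common kernels, i.e. with $\ker A_1\cap\ker A_2=\{0\}$ and $\ker A_1^\dagger\cap\ker A_2^\dagger=\{0\}$ (where $\dagger$ denotes the conjugate transpose of a complex matrix), can be transformed by some $g\in GL_n,h\in GL_m$ into the Kronecker canonical form $$g(sA_1+A_2)h^{\dagger} = L_{\epsilon_1} \oplus \cdots \oplus L_{\epsilon_c} \oplus (sC+D) \oplus L^{\dagger}_{\eta_d} \oplus L^{\dagger}_{\eta_{d-1}} \oplus \cdots \oplus L^{\dagger}_{\eta_1},$$ where $\oplus$ is block-diagonal sum, $sC+D$ is a regular pencil (possibly absent), and $\epsilon_1\le\cdots\le\epsilon_c$, $\eta_1\le\cdots\le\eta_d$ are positive integers (the uniquely determined minimal indices). Notation: $b$ is the number of diagonal blocks. For $\gamma\in\{1,\ldots,b\}$, $I_\gamma,J_\gamma$ are the row and column index sets of the $\gamma$-th diagonal block. $X_\gamma\subseteq\mathbb{C}^n$ is the span of the rows of $g$ with indices in $I_{\gamma+1}\cup\cdots\cup I_b$, and $Y_\gamma\subseteq\mathbb{C}^m$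 is the span of the rows of $h$ with indices in $J_1\cup\cdots\cup J_\gamma$; $(X_0,Y_0)=(\mathbb{C}^n,\{0\})$, $(X_b,Y_b)=(\{0\},\mathbb{C}^m)$. The indices $\gamma\in\{1,\ldots,b-1\}$ with $(|I_\gamma|,|J_\gamma|)\ne(|I_{\gamma+1}|,|J_{\gamma+1}|)$ are listed in increasing order as $\gamma_1<\cdots<\gamma_{\theta-1}$, and $\gamma_0:=0$, $\gamma_\theta:=b$. When $sC+D$ exists (it is then the $(c+1)$-st block) and is $n_0\times n_0$ upper triangular: $Z_\beta$ is the span of the rows of $g$ having the last $n_0-\beta$ indices in $I_{c+1}$, $W_\beta$ is the span of the rows of $h$ having the first $\beta$ indices in $J_{c+1}$, and $X_{c,\beta}:=X_{c+1}+Z_\beta$, $Y_{c,\beta}:=Y_c+W_\beta$. DM-flags: $\mathcal{S}_A$ is the set of pairs of subspaces $X\subseteq\mathbb{C}^n,Y\subseteq\mathbb{C}^m$ with $u^\top A_\ell\bar v=0$ for all $u\in X,v\in Y,\ell\in\{1,2\}$. $\phi(X,Y):=(\dim X,\dim Y)$. The coarse DM-flag of $A$ is the set $\mathcal{E}_A$ of $(X,Y)\in\mathcal{S}_A$ such that $\phi(X,Y)$ is an extreme point, other than $(0,0)$, of $\mathrm{Conv}\,\phi(\mathcal{S}_A)$. It is a finite set and forms a chain $\{(X'_\alpha,Y'_\alpha)\}_{\alpha=0}^{\theta'}$ with $\mathbb{C}^n=X'_0\supset\cdots\supset X'_{\theta'}=\{0\}$, $\{0\}=Y'_0\subset\cdots\subset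 Y'_{\theta'}=\mathbb{C}^m$. For $1\le\alpha\le\theta'$, $\mathcal{L}_A^\alpha$ is the set of $(X,Y)\in\mathcal{S}_A$ with $\phi(X,Y)$ on the segment between $\phi(X'_{\alpha-1},Y'_{\alpha-1})$ and $\phi(X'_\alpha,Y'_\alpha)$, ordered by $(X,Y)\preceq(X',Y')\Leftrightarrow X\supseteq X',\ Y\subseteq Y'$ (a modular lattice). A DM-flag of $A$ is a union over $\alpha$ of maximal chains of $\mathcal{L}_A^\alpha$, equivalently a maximal chain of $\bigcup_\alpha\mathcal{L}_A^\alpha$. *)

(* Defs.v *)
From HB Require Import structures.
From mathcomp Require Import all_boot all_order all_algebra.
From mathcomp Require Import sesquilinear spectral.
From mathcomp Require Import classical_sets reals convex.
From mathcomp Require Import complex.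

Set Implicit Arguments.
Unset Strict Implicit.
Unset Printing Implicit Defensive.

Import Order.TTheory GRing.Theory Num.Theory.

Local Open Scope ring_scope.
Local Open Scope sesquilinear_scope.

(* The indeterminate s is 'X. *)
Definition pencil (F : fieldType) n m (A1 A2 : 'M[F]_(n, m)) :
    'M[{poly F}]_(n, m) :=
  'X *: map_mx polyC A1 + map_mx polyC A2.

Definition regular_pencil (F : fieldType) n (C D : 'M[F]_n) : Prop :=
  exists s : F, \det (s *: C + D) != 0.

(* [is_trig_mx] is lower triangularity, hence the transposition. *)
Definition upper_triangular (F : fieldType) n (M : 'M[{poly F}]_n) : bool :=
  is_trig_mx M^T.

Definition Lmx (F : fieldType) (e : nat) : 'M[{poly F}]_(e, e.+1) :=
  \matrix_(i, j) if j == i :> nat then 1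
                 else if j == i.+1 :> nat then 'X else 0.

Record pblock (F : fieldType) := PBlock {
  brows : nat;
  bcols : nat;
  bmx : 'M[{poly F}]_(brows, bcols)
}.

Fixpoint block_diag (F : fieldType) (s : seq (pblock F)) :
    'M[{poly F}]_(sumn [seq brows B | B <- s], sumn [seq bcols B | B <- s]) :=
  match s with
  | [::] => 0
  | B :: s' => block_mx (bmx B) 0 0 (block_diag s')
  end.

(* [ksize = 0] encodes the absence of the regular block; [keps] and [keta] list
   the minimal indices in nondecreasing order. *)
Record kronecker (F : fieldType) := Kronecker {
  keps : seq nat;
  ksize : nat;
  kC : 'M[F]_ksize;
  kD : 'M[F]_ksize;
  keta : seq nat
}.

Definition is_canonical (F : fieldType) (K : kronecker F) : Prop :=
  [/\ all (leq 1) (keps K), sorted leq (keps K),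
      all (leq 1) (keta K), sorted leq (keta K) &
      regular_pencil (kC K) (kD K)].

Definition kblocks (F : fieldType) (K : kronecker F) : seq (pblock F) :=
  [seq PBlock (Lmx F e) | e <- keps K]
  ++ (if (0 < ksize K)%N then [:: PBlock (pencil (kC K) (kD K))] else [::])
  ++ [seq PBlock (Lmx F e)^T | e <- rev (keta K)].

Definition krows (F : fieldType) (K : kronecker F) : seq nat :=
  [seq brows B | B <- kblocks K].

Definition kcols (F : fieldType) (K : kronecker F) : seq nat :=
  [seq bcols B | B <- kblocks K].

Definition kmx (F : fieldType) (K : kronecker F) :
    'M[{poly F}]_(sumn (krows K), sumn (kcols K)) :=
  block_diag (kblocks K).

Definition nblocks (F : fieldType) (K : kronecker F) : nat := size (kblocks K).

(* C^n is the space of row vectors, so that u^T is written u. *)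
Definition row_span (F : fieldType) n (g : 'M[F]_n) (I : {set 'I_n}) :
    {vspace 'rV[F]_n} :=
  <<[seq row i g | i in I]>>%VS.

(* Position of the first index following the first k blocks. *)
Definition offset (sz : seq nat) (k : nat) : nat := sumn (take k sz).

(* Index set of the gamma-th block, where gamma starts at 1 while the matrix
   indices start at 0. *)
Definition block_idx (sz : seq nat) n (gamma : nat) : {set 'I_n} :=
  [set i : 'I_n | (offset sz gamma.-1 <= i < offset sz gamma)%N]%SET.

Definition Iset (F : fieldType) (K : kronecker F) n (gamma : nat) : {set 'I_n} :=
  block_idx (krows K) n gamma.

Definition Jset (F : fieldType) (K : kronecker F) m (gamma : nat) : {set 'I_m} :=
  block_idx (kcols K) m gamma.

Definition Xsp (F : fieldType) (K : kronecker F) n (g : 'M[F]_n) (gamma : nat) :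
    {vspace 'rV[F]_n} :=
  row_span g (\bigcup_(gamma.+1 <= k < (nblocks K).+1) Iset K n k)%SET.

Definition Ysp (F : fieldType) (K : kronecker F) m (h : 'M[F]_m) (gamma : nat) :
    {vspace 'rV[F]_m} :=
  row_span h (\bigcup_(1 <= k < gamma.+1) Jset K m k)%SET.

(* The sequence gamma_0 < gamma_1 < ... < gamma_theta, with gamma_0 = 0 and
   gamma_theta = nblocks K. *)
Definition gammas (F : fieldType) (K : kronecker F) (n m : nat) : seq nat :=
  0%N :: rcons [seq gamma <- iota 1 (nblocks K).-1 |
                (#|Iset K n gamma|, #|Jset K m gamma|)
                != (#|Iset K n gamma.+1|, #|Jset K m gamma.+1|)]
         (nblocks K).

Definition Zsp (F : fieldType) (K : kronecker F) n (g : 'M[F]_n) (beta : nat) :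
    {vspace 'rV[F]_n} :=
  let c := size (keps K) in
  row_span g [set i in Iset K n c.+1 | (offset (krows K) c + beta <= i)%N]%SET.

Definition Wsp (F : fieldType) (K : kronecker F) m (h : 'M[F]_m) (beta : nat) :
    {vspace 'rV[F]_m} :=
  let c := size (keps K) in
  row_span h [set j in Jset K m c.+1 | (j < offset (kcols K) c + beta)%N]%SET.

Definition Xcsp (F : fieldType) (K : kronecker F) n (g : 'M[F]_n) (beta : nat) :
    {vspace 'rV[F]_n} :=
  (Xsp K g (size (keps K)).+1 + Zsp K g beta)%VS.

Definition Ycsp (F : fieldType) (K : kronecker F) m (h : 'M[F]_m) (beta : nat) :
    {vspace 'rV[F]_m} :=
  (Ysp K h (size (keps K)) + Wsp K h beta)%VS.

Local Open Scope classical_set_scope.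

Definition convex_hull (R : realType) (E : lmodType R) (S : set E) : set E :=
  smallest (@convex_set R E) S.

Definition extreme_point (R : realType) (E : lmodType R) (S : set E) (z : E) :
    Prop :=
  S z /\ forall (x y : E) (t : R), S x -> S y -> 0 < t < 1 ->
    z = t *: x + (1 - t) *: y -> x = z /\ y = z.

Definition in_segment (R : realType) (E : lmodType R) (x y z : E) : Prop :=
  exists2 t : R, 0 <= t <= 1 & z = (1 - t) *: x + t *: y.

Definition kerv (F : fieldType) n m (A : 'M[F]_(n, m)) : {vspace 'cV[F]_m} :=
  lker (linfun (mulmx A)).

Definition sspair (R : realType) (n m : nat) : Type :=
  ({vspace 'rV[R[i]]_n} * {vspace 'rV[R[i]]_m})%type.

Definition vanishing_pairs (R : realType) n m (A1 A2 : 'M[R[i]]_(n, m)) :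
    set (sspair R n m) :=
  [set P : sspair R n m | forall (u : 'rV[R[i]]_n) (v : 'rV[R[i]]_m),
     u \in P.1 -> v \in P.2 ->
     u *m A1 *m v ^t* = 0 /\ u *m A2 *m v ^t* = 0].

Definition dimpair (R : realType) n m (P : sspair R n m) : (R^o * R^o)%type :=
  ((\dim P.1)%:R, (\dim P.2)%:R).

Definition coarse_DM_flag (R : realType) n m (A1 A2 : 'M[R[i]]_(n, m)) :
    set (sspair R n m) :=
  [set P | [/\ vanishing_pairs A1 A2 P,
     extreme_point (convex_hull (@dimpair R n m @` vanishing_pairs A1 A2))
                   (dimpair P) &
     dimpair P <> (0, 0)]].

Definition dm_le (R : realType) n m (P Q : sspair R n m) : Prop :=
  (Q.1 <= P.1)%VS /\ (P.2 <= Q.2)%VS.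

Definition coarse_chain (R : realType) n m (A1 A2 : 'M[R[i]]_(n, m))
    (theta : nat) (P : nat -> sspair R n m) : Prop :=
  [/\ coarse_DM_flag A1 A2 = P @` [set a | (a <= theta)%N],
      forall a, (a < theta)%N -> dm_le (P a) (P a.+1) /\ P a <> P a.+1,
      P 0%N = (fullv, 0%VS) & P theta = (0%VS, fullv)].

Definition segment_lattice (R : realType) n m (A1 A2 : 'M[R[i]]_(n, m))
    (P Q : sspair R n m) : set (sspair R n m) :=
  [set S | vanishing_pairs A1 A2 S /\
           in_segment (dimpair P) (dimpair Q) (dimpair S)].

Definition is_chain (R : realType) n m (M : set (sspair R n m)) : Prop :=
  total_on M (@dm_le R n m).

Definition maximal_chain (R : realType) n m (L M : set (sspair R n m)) : Prop :=
  [/\ M `<=` L, is_chain M &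
      forall M', M `<=` M' -> M' `<=` L -> is_chain M' -> M' = M].

Definition is_DM_flag (R : realType) n m (A1 A2 : 'M[R[i]]_(n, m))
    (F : set (sspair R n m)) : Prop :=
  exists theta (P : nat -> sspair R n m) (M : nat -> set (sspair R n m)),
    [/\ coarse_chain A1 A2 theta P,
        forall a, (1 <= a <= theta)%N ->
          maximal_chain (segment_lattice A1 A2 (P a.-1) (P a)) (M a) &
        F = \bigcup_(a in [set a | (1 <= a <= theta)%N]) M a].

(* Main.v *)
(* After the coordinate change (g, h), a pair (X, Y) annihilated by the pencil is
   annihilated by a block-diagonal pencil.  Intersecting with the first block and
   projecting to the others splits it into pairs (X_k, Y_k) annihilated by the
   single blocks, of size r_k x c_k, with dim X and dim Y the sums of the pieces.
   Each block is semistable, c_k dim X_k + r_k dim Y_k <= r_k c_k, and the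
   slopes c_k / r_k never increase along the canonical form.  So every dimension
   vector lies below the concave polygonal line through the points
   (dim X_gamma, dim Y_gamma), whose proper vertices are those where the block
   size changes; these are the nonzero extreme points.  A pair whose dimension
   vector is extreme is determined by it, by submodularity.

   For the second part, the proposed flag realises every lattice point of the
   polygonal line: sizes of singular blocks are coprime, and the triangular
   regular block is refined one dimension at a time.  A chain realising all
   possible dimension vectors is maximal, since comparable pairs of equal
   dimensions coincide. *)

Require Import Defs.
From HB Require Import structures.
From mathcomp Require Import all_boot all_order all_algebra.
From mathcomp Require Import sesquilinear spectral.
From mathcomp Require Import classical_sets reals interval_inference convex.
From mathcomp Require Import complex.
From mathcomp Require Import zify ring lra.

Set Implicit Arguments.
Unset Strict Implicit.
Unset Printing Implicit Defensive.

Import Order.TTheory GRing.Theory Num.Theory.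

Local Open Scope classical_set_scope.
Local Open Scope ring_scope.
Local Open Scope sesquilinear_scope.

(** * Semistability of the canonical blocks *)

Section Annihilation.
Variable F : fieldType.

(** Subspaces are given as row spaces. The condition is bilinear, so it makes sense over any field;
    the conjugation of the sesquilinear form is put into [Y] later. *)
Definition annihilates n m (P : 'M[{poly F}]_(n, m)) p q
    (X : 'M[F]_(p, n)) (Y : 'M[F]_(q, m)) : Prop :=
  map_mx polyC X *m P *m (map_mx polyC Y)^T = 0.

(** The dimension vector lies on or below the segment from [(n, 0)] to [(0, m)]: slope semistability
    with denominators cleared. *)
Definition semistable n m (P : 'M[{poly F}]_(n, m)) : Prop :=
  forall p q (X : 'M[F]_(p, n)) (Y : 'M[F]_(q, m)), annihilates P X Y ->
    (m * \rank X + n * \rank Y <= n * m)%N.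

Lemma mul_pencil p n m q (U : 'M[F]_(p, n)) (A B : 'M[F]_(n, m))
    (V : 'M[F]_(m, q)) :
  map_mx polyC U *m pencil A B *m map_mx polyC V
    = pencil (U *m A *m V) (U *m B *m V).
Proof.
by rewrite /pencil mulmxDr mulmxDl -scalemxAr -scalemxAl !map_mxM.
Qed.

Lemma pencil_eq0 n m (A B : 'M[F]_(n, m)) :
  pencil A B = 0 <-> A = 0 /\ B = 0.
Proof.
split=> [/matrixP AB0 | [-> ->]]; last first.
  by rewrite /pencil map_mx0 scaler0 addr0.
have coefAB i j k : ('X * (A i j)%:P + (B i j)%:P)`_k = 0.
  by have := AB0 i j; rewrite !mxE => ->; rewrite coef0.
split; apply/matrixP=> i j; rewrite mxE.
  by have := coefAB i j 1; rewrite coefD coefXM !coefC /= addr0.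
by have := coefAB i j 0; rewrite coefD coefXM !coefC /= add0r.
Qed.

Lemma annihilates_pencil n m (A B : 'M[F]_(n, m)) p q
    (X : 'M[F]_(p, n)) (Y : 'M[F]_(q, m)) :
  annihilates (pencil A B) X Y <-> X *m A *m Y^T = 0 /\ X *m B *m Y^T = 0.
Proof. by rewrite /annihilates map_trmx mul_pencil pencil_eq0. Qed.

Lemma annihilates_tr n m (P : 'M[{poly F}]_(n, m)) p q
    (X : 'M[F]_(p, n)) (Y : 'M[F]_(q, m)) :
  annihilates P X Y -> annihilates P^T Y X.
Proof.
move=> /(congr1 trmx); rewrite /annihilates trmx0 !trmx_mul trmxK => <-.
by rewrite mulmxA.
Qed.

Lemma semistable_tr n m (P : 'M[{poly F}]_(n, m)) :
  semistable P -> semistable P^T.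
Proof.
move=> sP p q X Y /annihilates_tr; rewrite trmxK => /sP.
by rewrite addnC [(m * n)%N]mulnC.
Qed.

(** At a value [s] where the pencil is invertible, [X (sC + D)] has the rank of [X] and is
    orthogonal to [Y], so the two ranks add up to at most [n]. *)
Lemma semistable_regular n (C D : 'M[F]_n) :
  regular_pencil C D -> semistable (pencil C D).
Proof.
move=> [s sCD] p q X Y /annihilates_pencil [XCY XDY].
have uCD : s *: C + D \in unitmx by rewrite unitmxE unitfE.
have : (X *m (s *: C + D)) *m Y^T = 0.
  by rewrite mulmxDr mulmxDl -scalemxAr -scalemxAl XCY XDY scaler0 addr0.
move/mulmx0_rank_max; rewrite mxrankMfree ?row_free_unit // mxrank_tr.
by rewrite -mulnDr leq_mul2l orbC => ->.
Qed.

(** [Y] is orthogonal to the sum [W] of [X J] and [X S], which is strictly larger than [X] unless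
    [X = 0]. Hence [rank Y <= e - x] with [x = rank X], and
    [(e+1) x + e (e-x) = e^2 + x <= e (e+1)]. *)
Lemma semistable_Lmx e : semistable (Lmx F e).
Proof.
pose J : 'M[F]_(e, e.+1) := \matrix_(i, j) (j == i :> nat)%:R.
pose S : 'M[F]_(e, e.+1) := \matrix_(i, j) (j == i.+1 :> nat)%:R.
have -> : Lmx F e = pencil S J.
  apply/matrixP=> i j; rewrite !mxE; have [->|_] := eqVneq (j : nat) i.
    by rewrite -[(i : nat) == _]negbK neq_ltn ltnSn mulr0 add0r.
  by case: eqP => _; rewrite ?mulr1 ?mulr0 addr0.
move=> p q X Y /annihilates_pencil [XSY XJY].
have XJE i k (lt_ke : (k < e)%N) :
    (X *m J) i (inord k) = X i (Ordinal lt_ke).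
  rewrite mxE (bigD1 (Ordinal lt_ke)) //= big1 ?addr0 => [|l /eqP ne_l].
    by rewrite mxE inordK ?eqxx ?mulr1 // ltnW.
  rewrite mxE inordK; last exact: ltnW.
  by case: eqP => [k_l | _]; [case: ne_l; apply: val_inj | rewrite mulr0].
have XSE i k (lt_ke : (k < e)%N) :
    (X *m S) i (inord k.+1) = X i (Ordinal lt_ke).
  rewrite mxE (bigD1 (Ordinal lt_ke)) //= big1 ?addr0 => [|l /eqP ne_l].
    by rewrite mxE inordK ?eqxx ?mulr1.
  rewrite mxE inordK // eqSS.
  by case: eqP => [k_l | _]; [case: ne_l; apply: val_inj | rewrite mulr0].
have [X0 | X_neq0] := eqVneq X 0.
  by rewrite X0 mxrank0 muln0 add0n leq_mul2l rank_leq_col orbT.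
pose W := col_mx (X *m J) (X *m S).
have WY : (\rank W + \rank Y <= e.+1)%N.
  rewrite -(mxrank_tr Y); apply: mulmx0_rank_max.
  by rewrite mul_col_mx XSY XJY col_mx0.
have rkXJ : \rank (X *m J) = \rank X.
  apply/eqP; rewrite eqn_leq mxrankM_maxl /=.
  (* The transpose of [J] is a right inverse of [J]. *)
  have {1}-> : X = X *m J *m (\matrix_(i, j) (i == j :> nat)%:R : 'M_(_, e)).
    apply/matrixP=> i j; rewrite mxE (bigD1 (inord j)) //= big1 => [|l ne_l].
      rewrite addr0 (XJE i j (ltn_ord j)) mxE inordK ?eqxx ?mulr1 //.
        by congr (X i _); apply: val_inj.
      exact: leqW.
    rewrite [X in _ * X]mxE; case: eqP => [l_j|]; last by rewrite mulr0.
    by case/eqP: ne_l; apply: val_inj; rewrite /= inordK -?l_j.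
  exact: mxrankM_maxl.
have ltXW : (\rank X < \rank W)%N.
  (* Otherwise the row space of X is stable under the right shift, which is
     nilpotent, and the last entries vanish on it, so the shift is injective
     there. *)
  rewrite ltnNge; apply: contra_neqN X_neq0 => leWX.
  have leJW : (X *m J <= W)%MS.
    by apply: submx_trans (addsmxSl _ (X *m S)) _; rewrite addsmxE.
  have : (X *m S <= X *m J)%MS.
    apply: (@submx_trans _ _ _ _ _ _ W).
      by apply: submx_trans (addsmxSr (X *m J) _) _; rewrite addsmxE.
    by have [_] := mxrank_leqif_sup leJW; rewrite rkXJ eqn_leq leWX andbT
         -rkXJ mxrankS // => <-.
  case/submxP=> Z XS_ZXJ.
  (* The last [k] columns of [X] vanish: column [j] of [X] is column [j+1] of [X S = Z X J], and
     column [j+1] of [X J] is column [j+1] of [X], or zero if [j+1 = e]. *)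
  have X0 k : forall i (j : 'I_e), (e <= j + k)%N -> X i j = 0.
    elim: k => [|k IHk] i j.
      by rewrite addn0 leqNgt ltn_ord.
    rewrite addnS => le_e_jk.
    have /matrixP/(_ i (inord j.+1)) := XS_ZXJ.
    rewrite (XSE _ _ (ltn_ord j)) => XijE.
    have -> : X i j = (Z *m (X *m J)) i (inord j.+1).
      by rewrite -XijE; congr (X i _); apply: val_inj.
    rewrite mxE big1 // => l _.
    have [lt_j1e | le_ej1] := ltnP j.+1 e.
      by rewrite (XJE _ _ lt_j1e) IHk ?mulr0 //= addSn.
    rewrite [(_ *m J) _ _]mxE big1 ?mulr0 // => l' _.
    rewrite mxE inordK; last by rewrite ltnS ltn_ord.
    by rewrite gtn_eqF ?mulr0 // (leq_trans (ltn_ord l')).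
  by apply/matrixP=> i j; rewrite (X0 e) ?leq_addl // mxE.
have rkX := rank_leq_col X.
nia.
Qed.

(** * Splitting along a block-diagonal pencil *)

Lemma annihilates_sub n m (P : 'M[{poly F}]_(n, m)) p q p' q'
    (X : 'M[F]_(p, n)) (Y : 'M[F]_(q, m))
    (X' : 'M[F]_(p', n)) (Y' : 'M[F]_(q', m)) :
  (X' <= X)%MS -> (Y' <= Y)%MS -> annihilates P X Y -> annihilates P X' Y'.
Proof.
move=> /submxP[U ->] /submxP[V ->] XPY.
rewrite /annihilates !map_mxM trmx_mul -!mulmxA.
by rewrite (mulmxA P) (mulmxA (map_mx _ X)) (mulmxA _ P) XPY mul0mx mulmx0.
Qed.

Lemma annihilates_block_row n1 m1 n2 m2 (B : 'M[{poly F}]_(n1, m1))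
    (C : 'M[{poly F}]_(n2, m2)) p q
    (X1 : 'M[F]_(p, n1)) (X2 : 'M[F]_(p, n2))
    (Y1 : 'M[F]_(q, m1)) (Y2 : 'M[F]_(q, m2)) :
  annihilates (block_mx B 0 0 C) (row_mx X1 X2) (row_mx Y1 Y2) <->
  map_mx polyC X1 *m B *m (map_mx polyC Y1)^T
    + map_mx polyC X2 *m C *m (map_mx polyC Y2)^T = 0.
Proof.
rewrite /annihilates !map_row_mx tr_row_mx mul_row_block !mulmx0 addr0 add0r.
by rewrite mul_row_col.
Qed.

(** [X] is projected to the first block and intersected with the second, [Y] the other way round. In
    each resulting pair one member has a zero component, which kills the contribution of the other
    block. Rank-nullity for the projections gives the rank sums. *)
Lemma annihilates_block n1 m1 n2 m2 (B : 'M[{poly F}]_(n1, m1))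
    (C : 'M[{poly F}]_(n2, m2)) p q
    (X : 'M[F]_(p, n1 + n2)) (Y : 'M[F]_(q, m1 + m2)) :
  annihilates (block_mx B 0 0 C) X Y ->
  exists (X1 : 'M[F]_(p, n1)) (Y1 : 'M[F]_(m1 + m2, m1))
         (X2 : 'M[F]_(n1 + n2, n2)) (Y2 : 'M[F]_(q, m2)),
    [/\ annihilates B X1 Y1, annihilates C X2 Y2,
        (\rank X1 + \rank X2 = \rank X)%N & (\rank Y1 + \rank Y2 = \rank Y)%N].
Proof.
move=> XY.
(* The kernels of the projections to the first and second block give [X'] inside the second block
   and [Y'] inside the first. *)
pose X' := (X :&: kermx (col_mx 1%:M 0 : 'M_(n1 + n2, n1)))%MS.
pose Y' := (Y :&: kermx (col_mx 0 1%:M : 'M_(m1 + m2, m2)))%MS.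
have X'E : X' = row_mx 0 (rsubmx X').
  have : X' *m col_mx 1%:M 0 = 0 by apply/sub_kermxP/capmxSr.
  rewrite -{1 2}[X']hsubmxK mul_row_col mulmx1 mulmx0 addr0 => X'1.
  by rewrite X'1.
have Y'E : Y' = row_mx (lsubmx Y') 0.
  have : Y' *m col_mx 0 1%:M = 0 by apply/sub_kermxP/capmxSr.
  rewrite -{1 2}[Y']hsubmxK mul_row_col mulmx1 mulmx0 add0r => Y'1.
  by rewrite Y'1.
exists (lsubmx X), (lsubmx Y'), (rsubmx X'), (rsubmx Y); split.
- have := annihilates_sub (submx_refl X) (capmxSl _ _ : (Y' <= Y)%MS) XY.
  rewrite Y'E -{1}[X]hsubmxK annihilates_block_row map_mx0 trmx0 mulmx0 addr0.
  by rewrite -Y'E.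
- have := annihilates_sub (capmxSl _ _ : (X' <= X)%MS) (submx_refl Y) XY.
  rewrite X'E -{1}[Y]hsubmxK annihilates_block_row map_mx0 !mul0mx add0r.
  by rewrite -X'E.
- rewrite -(mxrank_mul_ker X (col_mx 1%:M 0 : 'M_(n1 + n2, n1))).
  rewrite -/X' {2}X'E rank_row_0mx; congr (\rank _ + _)%N.
  by rewrite -{2}[X]hsubmxK mul_row_col mulmx1 mulmx0 addr0.
- rewrite -(mxrank_mul_ker Y (col_mx 0 1%:M : 'M_(m1 + m2, m2))).
  rewrite -/Y' {2}Y'E rank_row_mx0 addnC; congr (\rank _ + _)%N.
  by rewrite -{2}[Y]hsubmxK mul_row_col mulmx1 mulmx0 add0r.
Qed.

Definition stable_block (B : Defs.pblock F) : Prop :=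
  [/\ (0 < brows B)%N, (0 < bcols B)%N & semistable (bmx B)].

(** A linear functional on the triangle with vertices [(0, 0)], [(r, 0)], [(0, c)] is largest at a
    vertex. If [a r <= b c], use [c (a x + b y) = a (c x + r y) + (b c - a r) y]; the other case is
    symmetric. *)
Lemma weighted_rank_le r c a b x y :
  (0 < r)%N -> (0 < c)%N -> (c * x + r * y <= r * c)%N ->
  (a * x + b * y <= maxn (a * r) (b * c))%N.
Proof.
move=> r_gt0 c_gt0 le_rc; have [le_ab | lt_ba] := leqP (a * r)%N (b * c)%N.
  have le_yc : (y <= c)%N by rewrite -(leq_pmul2l r_gt0); lia.
  rewrite -(leq_pmul2l c_gt0).
  have := leq_mul (leqnn a) le_rc.
  have := leq_mul (leqnn (b * c - a * r)%N) le_yc.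
  nia.
have le_xr : (x <= r)%N by rewrite -(leq_pmul2l c_gt0); lia.
rewrite -(leq_pmul2l r_gt0).
have := leq_mul (leqnn b) le_rc.
have := leq_mul (leqnn (a * r - b * c)%N) le_xr.
nia.
Qed.

(* The Harder-Narasimhan argument: intersecting with and projecting to the
   blocks splits (X, Y) into pairs annihilated by the single blocks. *)
Lemma weighted_rank_block_diag a b (s : seq (Defs.pblock F)) :
  foldr (fun B => and (stable_block B)) True s -> forall p q
    (X : 'M[F]_(p, sumn [seq brows B | B <- s]))
    (Y : 'M[F]_(q, sumn [seq bcols B | B <- s])),
  annihilates (block_diag s) X Y ->
  (a * \rank X + b * \rank Y
     <= \sum_(B <- s) maxn (a * brows B) (b * bcols B))%N.
Proof.
elim: s => [_ | B s IHs] /=.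
  move=> p q X Y _; rewrite big_nil.
  have := rank_leq_col X; have := rank_leq_col Y; rewrite !leqn0.
  by move=> /eqP-> /eqP->; rewrite !muln0.
case=> [[r_gt0 c_gt0 sB] /IHs{}IHs] p q X Y.
case/annihilates_block=> [X1 [Y1 [X2 [Y2 [/sB B1 /IHs B2 <- <-]]]]].
rewrite big_cons !mulnDr addnACA leq_add //.
exact: weighted_rank_le.
Qed.
End Annihilation.
(** * Spans of rows *)

Section RowSpan.
Variable F : fieldType.

(** Passes from [vspace] dimensions to matrix ranks. *)
Definition vmx n (U : {vspace 'rV[F]_n}) : 'M[F]_(\dim U, n) :=
  \matrix_i (vbasis U)`_i.

Lemma rank_vmx n (U : {vspace 'rV[F]_n}) : \rank (vmx U) = \dim U.
Proof.
suff /eqP : row_free (vmx U) by [].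
apply/inj_row_free => v; rewrite mulmx_sum_row => vU0.
have /freeP/(_ (v 0)) v0 := basis_free (vbasisP U).
apply/rowP=> i; rewrite mxE v0 // -[RHS]vU0.
by apply: eq_bigr => j _; rewrite rowK.
Qed.

Lemma row_vmx_mem n (U : {vspace 'rV[F]_n}) i : row i (vmx U) \in U.
Proof. by rewrite rowK vbasis_mem // mem_nth // size_tuple. Qed.

Lemma mem_row_span n (g : 'M[F]_n) (I : {set 'I_n}) i :
  i \in I -> row i g \in row_span g I.
Proof. by move=> Ii; apply/memv_span/map_f; rewrite mem_enum. Qed.

Lemma row_span_sub n (g : 'M[F]_n) (I : {set 'I_n}) (U : {vspace 'rV[F]_n}) :
  (forall i, i \in I -> row i g \in U) -> (row_span g I <= U)%VS.
Proof.
by move=> IU; apply/span_subvP=> _ /mapP[i Ii ->]; rewrite IU // -mem_enum.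
Qed.

Lemma row_spanS n (g : 'M[F]_n) (I J : {set 'I_n}) :
  I \subset J -> (row_span g I <= row_span g J)%VS.
Proof. by move=> IJ; apply: row_span_sub => i /(fintype.subsetP IJ)/mem_row_span. Qed.

Lemma row_spanU n (g : 'M[F]_n) (I J : {set 'I_n}) :
  row_span g (I :|: J)%SET = (row_span g I + row_span g J)%VS.
Proof.
apply/eqP; rewrite eqEsubv subv_add.
rewrite !row_spanS ?finset.subsetUl ?finset.subsetUr ?andbT //.
apply: row_span_sub => i; rewrite finset.in_setU => /orP[] Ii.
  by apply: subvP (addvSl _ _) _ _; apply: mem_row_span.
by apply: subvP (addvSr _ _) _ _; apply: mem_row_span.
Qed.

Lemma row_spanT n (g : 'M[F]_n) : g \in unitmx -> row_span g (finset.setTfor 'I_n) = fullv.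
Proof.
move=> g_unit; apply/eqP; rewrite eqEsubv subvf; apply/subvP=> u _.
rewrite -(mulmxKV g_unit u) mulmx_sum_row.
by apply: memv_suml => i _; apply/memvZ/mem_row_span; rewrite inE.
Qed.

(** The spans for [I] and its complement have at most as many dimensions as indices and together
    fill the space, so both bounds are equalities. *)
Lemma dim_row_span n (g : 'M[F]_n) (I : {set 'I_n}) :
  g \in unitmx -> \dim (row_span g I) = #|I|.
Proof.
move=> g_unit.
have dim_le J : (\dim (row_span g J) <= #|J|)%N.
  by rewrite (leq_trans (dim_span _)) // size_map -cardE.
apply/eqP; rewrite eqn_leq dim_le /= -(leq_add2r #|~: I|%SET) cardsC card_ord.
apply: (@leq_trans (\dim (row_span g (I :|: ~: I)%SET))).
  by rewrite finset.setUCr row_spanT // dimvf /dim /= mul1n.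
by rewrite row_spanU (leq_trans (dimv_add_leqif _ _)) // leq_add.
Qed.

Lemma row_span_coord n (g : 'M[F]_n) (I : {set 'I_n}) u i :
  g \in unitmx -> u \in row_span g I -> i \notin I -> (u *m invmx g) 0 i = 0.
Proof.
move=> g_unit /coord_span -> I'i; rewrite mulmx_suml summxE big1 // => k _.
rewrite -scalemxAl mxE; set w := (X in X *m invmx g).
have : w \in [seq row j g | j in I].
  by rewrite mem_nth // size_tuple.
case/mapP=> j; rewrite mem_enum => Ij /= ->.
rewrite -row_mul mulmxV // !mxE; case: eqP => [j_i|]; last by rewrite mulr0.
by rewrite -j_i Ij in I'i.
Qed.

End RowSpan.
(** * Extreme points in the plane *)

Section ConvexHull.
Variable R : realType.
Implicit Types (E : lmodType R) (a b c t : R).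

Lemma sub_convex_hull E (T : set E) : T `<=` convex_hull T.
Proof. by move=> z Tz M [_]; apply. Qed.

Lemma convex_hull_conv E (T : set E) (x y : E) t :
  convex_hull T x -> convex_hull T y -> 0 <= t <= 1 ->
  convex_hull T (t *: x + (1 - t) *: y).
Proof.
move=> Tx Ty /andP[t_ge0 t_le1] M [convM TM].
have := convM x y (Itv01 t_ge0 t_le1); rewrite !inE; apply; first exact: Tx.
exact: Ty.
Qed.

Lemma convex_hull_halfplane (T : set (R^o * R^o)%type) a b c :
  (forall z, T z -> a * z.1 + b * z.2 <= c) ->
  forall z, convex_hull T z -> a * z.1 + b * z.2 <= c.
Proof.
move=> Tc z; apply: (_ : convex_hull T `<=` [set w | a * w.1 + b * w.2 <= c]).
apply: smallest_sub => // x y t; rewrite !inE /= => xc yc.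
have t_ge0 : 0 <= t%:num :> R by [].
have t_le1 : 0 <= 1 - t%:num :> R by rewrite subr_ge0.
change (a * (t%:num * x.1 + (1 - t%:num) * y.1)
  + b * (t%:num * x.2 + (1 - t%:num) * y.2) <= c).
have := lerD (ler_wpM2l t_ge0 xc) (ler_wpM2l t_le1 yc).
have -> : t%:num * c + (1 - t%:num) * c = c by ring.
by apply: le_trans; rewrite le_eqVlt; apply/orP; left; apply/eqP; ring.
Qed.

(** Both functionals are maximal at [p] on the whole hull, so the ends of a proper convex
    combination equal to [p] attain both maxima. Two independent linear equations then leave only
    [p]. *)
Lemma extreme_point_vertex (T : set (R^o * R^o)%type) (p : (R^o * R^o)%type)
    a b a' b' :
  a * b' != a' * b -> T p ->
  (forall z, T z -> a * z.1 + b * z.2 <= a * p.1 + b * p.2) ->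
  (forall z, T z -> a' * z.1 + b' * z.2 <= a' * p.1 + b' * p.2) ->
  extreme_point (convex_hull T) p.
Proof.
move=> indep Tp Tab Tab'; split=> [|x y t Tx Ty /andP[t_gt0 t_lt1] p_xy].
  exact: sub_convex_hull.
have eqxy (fx fy fp : R) : fp = t * fx + (1 - t) * fy -> fx <= fp ->
    fy <= fp -> fx = fp /\ fy = fp.
  by move=> fpE le_x le_y; split; nra.
have p1E : p.1 = t * x.1 + (1 - t) * y.1 by rewrite p_xy.
have p2E : p.2 = t * x.2 + (1 - t) * y.2 by rewrite p_xy.
have [] := eqxy (a * x.1 + b * x.2) (a * y.1 + b * y.2)
  (a * p.1 + b * p.2).
- by rewrite p1E p2E; ring.
- exact: convex_hull_halfplane Tab _ Tx.
- exact: convex_hull_halfplane Tab _ Ty.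
have [] := eqxy (a' * x.1 + b' * x.2) (a' * y.1 + b' * y.2)
  (a' * p.1 + b' * p.2).
- by rewrite p1E p2E; ring.
- exact: convex_hull_halfplane Tab' _ Tx.
- exact: convex_hull_halfplane Tab' _ Ty.
(* Cramer's rule. *)
have solve (z : (R^o * R^o)%type) : a * z.1 + b * z.2 = a * p.1 + b * p.2 ->
    a' * z.1 + b' * z.2 = a' * p.1 + b' * p.2 -> z = p.
  have det_neq0 : a * b' - a' * b != 0 by rewrite subr_eq0.
  case: z => z1 z2 /= eq1 eq2; rewrite [p]surjective_pairing.
  congr (_, _); apply: (mulfI det_neq0).
    transitivity (b' * (a * z1 + b * z2) - b * (a' * z1 + b' * z2)).
      by ring.
    by rewrite eq1 eq2; ring.
  transitivity (a * (a' * z1 + b' * z2) - a' * (a * z1 + b * z2)); first by ring.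
  by rewrite eq1 eq2; ring.
by move=> eq1 eq2 eq3 eq4; split; apply: solve.
Qed.

End ConvexHull.
(** * Sizes and offsets of the blocks *)

Section Offset.
Local Open Scope nat_scope.
Implicit Types (s : seq nat) (a b k l n : nat).

Lemma offset0 s : offset s 0 = 0.
Proof. by rewrite /offset take0. Qed.

Lemma offset_size s k : size s <= k -> offset s k = sumn s.
Proof. by move=> le_sk; rewrite /offset take_oversize. Qed.

Lemma offsetS s k : offset s k.+1 = offset s k + nth 0 s k.
Proof.
have [lt_ks | le_sk] := ltnP k (size s).
  by rewrite /offset (take_nth 0) // sumn_rcons.
by rewrite !offset_size ?nth_default ?addn0 // leqW.
Qed.

Lemma leq_offset s : {homo offset s : k l / k <= l}.
Proof.
by apply: homo_leq => [//|k l p /leq_trans|k]; [apply | rewrite offsetS leq_addr].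
Qed.

Lemma offset_le_sumn s k : offset s k <= sumn s.
Proof. by rewrite -(@offset_size s (maxn k (size s))) ?leq_offset ?leq_maxr ?leq_maxl. Qed.

Lemma offset_between s d : 0 < size s -> d <= sumn s ->
  exists2 k, k < size s & offset s k <= d <= offset s k.+1.
Proof.
move=> s_gt0 le_ds.
(* The block sought is the first one whose end reaches [d]. *)
have ex_k : exists k, d <= offset s k.+1.
  by exists (size s).-1; rewrite prednK // offset_size.
case: (ex_minnP ex_k) => k le_dk min_k; exists k.
  by rewrite -(prednK s_gt0) ltnS min_k // prednK // offset_size.
rewrite le_dk andbT; case: k min_k {le_dk} => [|k] min_k; first by rewrite offset0.
by rewrite leqNgt; apply/negP => /ltnW/min_k; rewrite ltnn.
Qed.

Lemma offset_const s k l r : k <= l ->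
  (forall i, k <= i < l -> nth 0 s i = r) ->
  offset s l = offset s k + (l - k) * r.
Proof.
move=> le_kl; rewrite -{1 2}(subnKC le_kl); elim: (l - k) => [|d IHd] s_r.
  by rewrite mul0n !addn0.
rewrite addnS offsetS IHd => [|i /andP[le_ki lt_i]].
  by rewrite s_r ?leq_addr ?addnS //= mulSn; lia.
by rewrite s_r // le_ki addnS ltnW.
Qed.

Lemma card_ord_interval n a b : b <= n ->
  #|[set i : 'I_n | a <= i < b]%SET| = b - a.
Proof.
move=> le_bn; rewrite -sum1_card big_mkcond /=.
under eq_bigr do rewrite finset.in_set.
(* With the minimum the formula holds for all [n], so that induction on [n] goes through. *)
have -> : b - a = minn n b - a by rewrite (minn_idPr le_bn).
elim: n {le_bn} => [|n IHn]; first by rewrite big_ord0 min0n sub0n.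
by rewrite big_ord_recr /= IHn; case: ifP; lia.
Qed.

Lemma card_block_idx s n k :
  0 < k -> sumn s = n -> #|block_idx s n k| = nth 0 s k.-1.
Proof.
case: k => // k _ <-; rewrite card_ord_interval ?offset_le_sumn //= offsetS.
by rewrite addKn.
Qed.

Lemma bigcup_block_idx s n a b : a <= b ->
  (\bigcup_(a.+1 <= k < b.+1) block_idx s n k)%SET
    = [set i : 'I_n | offset s a <= i < offset s b]%SET.
Proof.
have empty l : (\bigcup_(l.+1 <= k < l.+1) block_idx s n k)%SET
    = [set i : 'I_n | offset s l <= i < offset s l]%SET.
  by rewrite big_geq //; apply/setP=> i; rewrite !finset.in_set; lia.
elim: b => [|b IHb]; first by rewrite leqn0 => /eqP->.
rewrite leq_eqVlt => /orP[/eqP-> // | le_ab].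
rewrite big_nat_recr // IHb //; apply/setP=> i; rewrite !finset.in_set /=.
have := leq_offset s (le_ab : a <= b); have := leq_offset s (leqnSn b).
lia.
Qed.

End Offset.
Section KroneckerSizes.
Variables (F : fieldType) (K : kronecker F).
Hypothesis K_canonical : is_canonical K.
Local Open Scope nat_scope.

Definition block_sizes : seq (nat * nat) :=
  [seq (brows B, bcols B) | B <- kblocks K].

Lemma block_sizesE : block_sizes =
  [seq (e, e.+1) | e <- keps K]
  ++ (if 0 < ksize K then [:: (ksize K, ksize K)] else [::])
  ++ [seq (e.+1, e) | e <- rev (keta K)].
Proof.
by rewrite /block_sizes /kblocks !map_cat -!map_comp; case: ifP.
Qed.

Lemma size_block_sizes : size block_sizes = nblocks K.
Proof. exact: size_map. Qed.

Lemma nth_krows k : nth 0 (krows K) k = (nth (0, 0) block_sizes k).1.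
Proof.
have -> : krows K = unzip1 block_sizes by rewrite /unzip1 -map_comp.
have [lt_k | le_k] := ltnP k (size block_sizes); first by rewrite (nth_map (0, 0)).
by rewrite (nth_default _ le_k) nth_default // size_map.
Qed.

Lemma nth_kcols k : nth 0 (kcols K) k = (nth (0, 0) block_sizes k).2.
Proof.
have -> : kcols K = unzip2 block_sizes by rewrite /unzip2 -map_comp.
have [lt_k | le_k] := ltnP k (size block_sizes); first by rewrite (nth_map (0, 0)).
by rewrite (nth_default _ le_k) nth_default // size_map.
Qed.

(** Positive minimal indices keep both sides of each block nonempty, and a square block can only be
    the regular one. *)
Lemma block_size_cases k : k < nblocks K ->
  let p := nth (0, 0) block_sizes k in
  [/\ 0 < p.1, 0 < p.2 &
    [\/ p.2 = p.1.+1,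
        [/\ k = size (keps K), 0 < ksize K & p = (ksize K, ksize K)] |
        p.1 = p.2.+1]].
Proof.
case: K_canonical => eps_gt0 _ eta_gt0 _ _; rewrite -size_block_sizes.
rewrite block_sizesE !nth_cat !size_cat !size_map => lt_k; cbv zeta.
case: (ltnP k (size (keps K))) => [lt_k_eps | le_eps_k].
  rewrite (nth_map 0) //=.
  split; [by apply: (allP eps_gt0); apply: mem_nth | by [] | by constructor 1].
case: ifP lt_k => [ks_gt0 | _] /=; last first.
  rewrite subn0 add0n size_rev => lt_k.
  rewrite (nth_map 0) ?size_rev /=; last by lia.
  split; [by [] | | by constructor 3].
  by apply: (allP eta_gt0); rewrite -mem_rev mem_nth // size_rev ltn_subLR.
rewrite size_rev => lt_k; case: (ltnP (k - size (keps K)) 1) => [lt_k1 | le_1k].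
  have -> : k = size (keps K) by lia.
  by rewrite subnn /=; split; [by [] | by [] | by constructor 2].
have lt_k' : k - size (keps K) - 1 < size (keta K) by lia.
rewrite (nth_map 0) ?size_rev //=.
split; [by [] | | by constructor 3].
by apply: (allP eta_gt0); rewrite -mem_rev mem_nth // size_rev.
Qed.

(** Slopes are compared by cross-multiplication: [(e+1)/e] falls towards 1 as [e] grows, the regular
    block has slope 1, and [e/(e+1)] falls along the reversed list. *)
Lemma block_slopes j k : j < k -> k < nblocks K ->
  let p := nth (0, 0) block_sizes j in
  let q := nth (0, 0) block_sizes k in
  q.2 * p.1 <= p.2 * q.1.
Proof.
case: K_canonical => _ eps_sorted _ eta_sorted _ lt_jk lt_k; cbv zeta.
suff pw : pairwise (fun p q : nat * nat =>
    q.2 * p.1 <= p.2 * q.1) block_sizes.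
  by apply: (pairwiseP (0, 0) pw); rewrite ?inE ?size_block_sizes // (ltn_trans lt_jk).
rewrite block_sizesE !pairwise_cat !pairwise_map.
have pw_eps : pairwise (relpre (fun e => (e, e.+1)) (fun p q : nat * nat =>
    q.2 * p.1 <= p.2 * q.1)) (keps K).
  rewrite (sorted_pairwise leq_trans) in eps_sorted.
  by apply: sub_pairwise eps_sorted => x y /=; lia.
have pw_eta : pairwise (relpre (fun e => (e.+1, e)) (fun p q : nat * nat =>
    q.2 * p.1 <= p.2 * q.1)) (rev (keta K)).
  have geq_trans : transitive geq by move=> x y z /= le_yx le_zy; lia.
  rewrite -rev_sorted (sorted_pairwise geq_trans) in eta_sorted.
  by apply: sub_pairwise eta_sorted => x y /=; lia.
rewrite pw_eps pw_eta allrel_catr !andbT.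
have -> /= : allrel (fun p q : nat * nat => q.2 * p.1 <= p.2 * q.1)
    [seq (e, e.+1) | e <- keps K] [seq (e.+1, e) | e <- rev (keta K)].
  by apply/allrelP=> _ _ /mapP[x _ ->] /mapP[y _ ->] /=; lia.
case: ifP => _; rewrite ?allrel0r ?allrel0l //= ?andbT.
apply/andP; split; apply/allrelP.
  by move=> _ y /mapP[x _ ->]; rewrite inE => /eqP-> /=; lia.
by move=> y z; rewrite inE => /eqP-> /mapP[x _ ->] /=; lia.
Qed.

(** Hence the polygonal line really bends wherever the block size changes. Slopes of singular blocks
    are reduced fractions different from 1, and there is at most one regular block. *)
Lemma block_slope_inj j k : j < nblocks K -> k < nblocks K ->
  let p := nth (0, 0) block_sizes j in
  let q := nth (0, 0) block_sizes k in
  q.2 * p.1 = p.2 * q.1 -> p = q.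
Proof.
move=> /block_size_cases; case: (nth _ _ j) => r c /= [r_gt0 c_gt0 Dj].
move=> /block_size_cases; case: (nth _ _ k) => r' c' /= [r'_gt0 c'_gt0 Dk] e.
by case: Dj => [cE | [_ _ [rE cE]] | rE]; case: Dk => [c'E | [_ _ [r'E c'E]] | r'E];
  congr (_, _); nia.
Qed.

(** * Indices at which the block size changes *)

Section Gammas.
Variables n m : nat.
Hypotheses (rowsK : sumn (krows K) = n) (colsK : sumn (kcols K) = m).
Hypothesis nblocks_gt0 : 0 < nblocks K.

(** Blocks are numbered from 1 but listed from 0, so blocks [k] and [k+1] are the entries [k.-1] and
    [k]. *)
Lemma mem_gammas k : (k \in gammas K n m) =
  [|| k == 0, k == nblocks K |
      [&& 0 < k < nblocks K &
          nth (0, 0) block_sizes k.-1 != nth (0, 0) block_sizes k]].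
Proof.
rewrite inE mem_rcons inE mem_filter mem_iota add1n prednK //; do 2!congr (_ || _).
rewrite andbC; case: (posnP k) => //= k_gt0; congr (_ && (_ != _)).
  by rewrite /Iset /Jset !card_block_idx // nth_krows nth_kcols -surjective_pairing.
by rewrite /Iset /Jset !card_block_idx //= nth_krows nth_kcols -surjective_pairing.
Qed.

Lemma sorted_gammas : sorted ltn (gammas K n m).
Proof.
rewrite /gammas /= rcons_path.
have sorted_f a : sorted ltn [seq gamma <- iota 1 (nblocks K).-1 | a gamma].
  by rewrite sorted_filter ?iota_ltn_sorted //; apply: ltn_trans.
set f := filter _ _; have f_lt : {in f, forall k, 0 < k < nblocks K}.
  by move=> k; rewrite mem_filter mem_iota => /andP[_]; lia.
apply/andP; split; last first.
  by have := mem_last 0 f; rewrite inE => /predU1P[->|/f_lt/andP[]].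
rewrite path_sortedE; last exact: ltn_trans.
by rewrite sorted_f andbT; apply/allP=> k /f_lt/andP[].
Qed.

Lemma nth_gammas_lt a : a.+1 < size (gammas K n m) ->
  nth 0 (gammas K n m) a < nth 0 (gammas K n m) a.+1.
Proof. by move=> lt_a; apply: (sortedP 0 sorted_gammas). Qed.

Lemma size_gammas_gt1 : 1 < size (gammas K n m).
Proof. by rewrite /gammas /= size_rcons. Qed.

Lemma nth_gammas_last :
  nth 0 (gammas K n m) (size (gammas K n m)).-1 = nblocks K.
Proof. by rewrite nth_last /gammas /= last_rcons. Qed.

Lemma gammas_le a : nth 0 (gammas K n m) a <= nblocks K.
Proof.
have [lt_a | le_a] := ltnP a (size (gammas K n m)); last by rewrite nth_default.
have := mem_nth 0 lt_a; rewrite mem_gammas.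
by case/or3P=> [/eqP-> // | /eqP-> // | /andP[/andP[_ /ltnW]]].
Qed.

Lemma gammas_between k : k < nblocks K ->
  exists2 a, a.+1 < size (gammas K n m) &
    nth 0 (gammas K n m) a <= k < nth 0 (gammas K n m) a.+1.
Proof.
move=> lt_k; have ex_a : exists a, k < nth 0 (gammas K n m) a.
  by exists (size (gammas K n m)).-1; rewrite nth_gammas_last.
case: (ex_minnP ex_a) => -[|a] lt_ka min_a; first by rewrite ltn0 in lt_ka.
exists a; last by rewrite lt_ka andbT leqNgt; apply/negP=> /min_a; rewrite ltnn.
by rewrite ltnNge; apply/negP=> le_a; rewrite nth_default in lt_ka.
Qed.

(** Induction on the distance from the start of the piece: an index strictly between consecutive
    terms of the list is not in it, so the sizes on its two sides agree. *)
Lemma block_sizes_gammas a k : a.+1 < size (gammas K n m) ->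
  nth 0 (gammas K n m) a <= k < nth 0 (gammas K n m) a.+1 ->
  nth (0, 0) block_sizes k
    = nth (0, 0) block_sizes (nth 0 (gammas K n m) a).
Proof.
move=> lt_a /andP[le_k]; rewrite -(subnKC le_k).
elim: (k - _) => [|d IHd] lt_k; first by rewrite addn0.
rewrite -IHd; last by rewrite (leq_trans _ lt_k) // addnS.
set l := _ + d.+1; have l_pred : l.-1 = nth 0 (gammas K n m) a + d.
  by rewrite /l addnS.
have lt_al : nth 0 (gammas K n m) a < l by rewrite /l addnS ltnS leq_addr.
have : (l \in gammas K n m) = false.
  apply/negP=> /(nthP 0)[a' lt_a' l_a'].
  have ltg := sorted_ltn_nth ltn_trans 0 sorted_gammas.
  have [] := ltngtP a' a.+1 => [lt_a'a | lt_aa' | aE].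
  - move: lt_a'a; rewrite ltnS leq_eqVlt => /predU1P[aE | lt_a'a].
      by move: lt_al; rewrite -l_a' aE ltnn.
    have := ltg _ _ lt_a' (ltnW lt_a) lt_a'a.
    by rewrite l_a' ltnNge ltnW.
  - by have := ltg _ _ lt_a lt_a' lt_aa'; rewrite l_a' ltnNge ltnW.
  - by move: lt_k; rewrite -/l -l_a' aE ltnn.
rewrite mem_gammas l_pred (leq_trans _ lt_al) //.
rewrite (leq_trans lt_k (gammas_le a.+1)) /=.
by move/norP=> [_ /norP[_ /negPn/eqP]].
Qed.

End Gammas.
End KroneckerSizes.
(** * Lattice points of the polygonal line *)

Section Boundary.
Variable F : fieldType.

(** A common form for the spaces [X] of both families in the flag; [head_span] does the same for
    [Y]. *)
Definition tail_span n (g : 'M[F]_n) (a : nat) : {vspace 'rV[F]_n} :=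
  row_span g [set i : 'I_n | (a <= i)%N]%SET.

Definition head_span n (g : 'M[F]_n) (b : nat) : {vspace 'rV[F]_n} :=
  row_span g [set i : 'I_n | (i < b)%N]%SET.

Lemma dim_tail_span n (g : 'M[F]_n) a :
  g \in unitmx -> \dim (tail_span g a) = (n - a)%N.
Proof.
move=> g_unit; rewrite dim_row_span // -(card_ord_interval a (leqnn n)).
by apply: eq_card => i; rewrite !finset.in_set ltn_ord andbT.
Qed.

Lemma dim_head_span n (g : 'M[F]_n) b :
  g \in unitmx -> (b <= n)%N -> \dim (head_span g b) = b.
Proof.
move=> g_unit le_bn; rewrite dim_row_span // -[RHS]subn0.
rewrite -(card_ord_interval 0 le_bn).
by apply: eq_card => i; rewrite !finset.in_set.
Qed.

Lemma tail_spanS n (g : 'M[F]_n) a a' :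
  (a <= a')%N -> (tail_span g a' <= tail_span g a)%VS.
Proof.
move=> le_aa'; apply/row_spanS/fintype.subsetP=> i; rewrite !finset.in_set.
exact: leq_trans.
Qed.

Lemma head_spanS n (g : 'M[F]_n) b b' :
  (b <= b')%N -> (head_span g b <= head_span g b')%VS.
Proof.
move=> le_bb'; apply/row_spanS/fintype.subsetP=> i; rewrite !finset.in_set.
by move=> lt_ib; apply: leq_trans le_bb'.
Qed.

Variable K : kronecker F.

Lemma XspE n (g : 'M[F]_n) k : sumn (krows K) = n -> (k <= nblocks K)%N ->
  Xsp K g k = tail_span g (offset (krows K) k).
Proof.
move=> rowsK le_k; rewrite /Xsp bigcup_block_idx //; congr row_span.
apply/setP=> i; rewrite !finset.in_set (@offset_size _ (nblocks K)) ?size_map //.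
by rewrite rowsK ltn_ord andbT.
Qed.

Lemma YspE m (h : 'M[F]_m) k : Ysp K h k = head_span h (offset (kcols K) k).
Proof.
rewrite /Ysp bigcup_block_idx //; congr row_span.
by apply/setP=> i; rewrite !finset.in_set offset0.
Qed.

Hypothesis K_canonical : is_canonical K.

Lemma regular_block : (0 < ksize K)%N ->
  exists s, kblocks K = [seq PBlock (Lmx F e) | e <- keps K]
                        ++ PBlock (pencil (kC K) (kD K)) :: s.
Proof. by rewrite /kblocks => ->; eexists. Qed.

Lemma regular_block_lt : (0 < ksize K)%N -> (size (keps K) < nblocks K)%N.
Proof.
move=> /regular_block[s Ks].
by rewrite /nblocks Ks size_cat size_map /= addnS ltnS leq_addr.
Qed.

Lemma nth_regular : (0 < ksize K)%N ->
  nth (0, 0)%N (block_sizes K) (size (keps K)) = (ksize K, ksize K).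
Proof.
move=> /regular_block[s Ks].
by rewrite /block_sizes Ks map_cat nth_cat !size_map ltnn subnn.
Qed.

Lemma XcspE n (g : 'M[F]_n) b : sumn (krows K) = n ->
  (0 < ksize K)%N -> (b <= ksize K)%N ->
  Xcsp K g b = tail_span g (offset (krows K) (size (keps K)) + b).
Proof.
move=> rowsK ks_gt0 le_b; rewrite /Xcsp XspE ?regular_block_lt //.
rewrite /tail_span /Zsp -row_spanU; congr row_span.
apply/setP=> i; rewrite finset.in_setU !finset.in_set offsetS nth_krows.
by rewrite nth_regular //=; lia.
Qed.

Lemma YcspE m (h : 'M[F]_m) b :
  (0 < ksize K)%N -> (b <= ksize K)%N ->
  Ycsp K h b = head_span h (offset (kcols K) (size (keps K)) + b).
Proof.
move=> ks_gt0 le_b; rewrite /Ycsp YspE.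
rewrite /head_span /Wsp -row_spanU; congr row_span.
apply/setP=> i; rewrite finset.in_setU !finset.in_set /= offsetS nth_kcols.
by rewrite nth_regular //=; lia.
Qed.

(* The lattice points on the polygonal line whose vertices are the points
   (offset (krows K) k, offset (kcols K) k). *)
Definition boundary (p : nat * nat) : Prop :=
  exists k i j, [/\ (k < nblocks K)%N,
    (i <= nth 0 (krows K) k)%N, (j <= nth 0 (kcols K) k)%N,
    (i * nth 0 (kcols K) k = j * nth 0 (krows K) k)%N &
    p = (offset (krows K) k + i, offset (kcols K) k + j)%N].

(** As [r] and [r+1] are coprime, the edge of a singular block has no lattice points besides its
    ends. *)
Lemma mul_consecutive i j r : (0 < r)%N -> (i <= r)%N ->
  (i * r.+1 = j * r)%N -> (i = 0 /\ j = 0 \/ i = r /\ j = r.+1)%N.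
Proof.
move=> r_gt0 le_ir ij; have [i0 | i_gt0] := posnP i.
  by left; split=> //; move/eqP: ij; rewrite i0 mul0n eq_sym muln_eq0; lia.
have lt_ij : (i < j)%N by rewrite -(ltn_pmul2r r_gt0) -ij ltn_pmul2l.
have i_r : i = r by have := leq_mul lt_ij (leqnn r); lia.
right; split=> //; apply/eqP; rewrite -(eqn_pmul2r r_gt0) -ij i_r.
by rewrite mulnC.
Qed.

(** Only the regular block, whose edge has slope 1, contributes lattice points inside an edge. The
    range [1 <= b <= (ksize K).-1] is empty when that block is absent or of size 1. *)
Lemma boundaryP (p : nat * nat) : (0 < nblocks K)%N -> boundary p <->
  (exists2 k, (k <= nblocks K)%N & p = (offset (krows K) k, offset (kcols K) k))
  \/ (exists2 b, (1 <= b <= (ksize K).-1)%N &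
        p = (offset (krows K) (size (keps K)) + b,
             offset (kcols K) (size (keps K)) + b)%N).
Proof.
move=> nb_gt0; split=> [[k [i [j [lt_k]]]] | ].
  rewrite nth_krows nth_kcols; have := block_size_cases K_canonical lt_k.
  have := offsetS (krows K) k; have := offsetS (kcols K) k.
  rewrite nth_krows nth_kcols; case: nth => r c /= cE rE [r_gt0 c_gt0 rc].
  move=> le_i le_j ij_rc ->.
  have corner : (i = 0 /\ j = 0 \/ i = r /\ j = c)%N ->
    (exists2 l, (l <= nblocks K)%N &
       (offset (krows K) k + i, offset (kcols K) k + j)%N
       = (offset (krows K) l, offset (kcols K) l)).
    case=> [[-> ->] | [-> ->]]; last by exists k.+1; rewrite // rE cE.
    by exists k; rewrite ?addn0 // ltnW.
  case: rc => [c_r | [kE ks_gt0 [r_ks c_ks]] | r_c].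
  - by left; apply: corner; rewrite c_r in ij_rc *; apply: mul_consecutive.
  - have i_j : i = j by nia.
    have [i0 | i_gt0] := posnP i; first by left; apply: corner; lia.
    have [i_r | ne_ir] := eqVneq i r; first by left; apply: corner; lia.
    by right; exists i; rewrite ?kE ?i_j //; lia.
  - left; apply: corner; rewrite r_c in ij_rc *.
    by case: (mul_consecutive c_gt0 le_j (esym ij_rc)) => -[-> ->]; [left | right].
case=> [[k le_k ->] | [b b_ks ->]].
  case: k le_k => [|k] le_k.
    by exists 0%N, 0%N, 0%N; rewrite !addn0.
  exists k, (nth 0 (krows K) k), (nth 0 (kcols K) k).
  by split; rewrite // ?offsetS // mulnC.
have ks_gt0 : (0 < ksize K)%N by lia.
exists (size (keps K)), b, b; rewrite nth_krows nth_kcols nth_regular //=.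
by split; rewrite ?regular_block_lt //; lia.
Qed.

Lemma boundary_total p q : boundary p -> boundary q ->
  (p.1 <= q.1)%N && (p.2 <= q.2)%N \/ (q.1 <= p.1)%N && (q.2 <= p.2)%N.
Proof.
(* Points are ordered by their block, then by [i] within it. Different blocks are separated by a
   vertex; within one block the positive slope makes [j] increase with [i]. *)
suff mono k i j k' i' j' :
    (k < k' < nblocks K)%N || (k == k') && (i <= i')%N && (k < nblocks K)%N ->
    (i <= nth 0 (krows K) k)%N -> (j <= nth 0 (kcols K) k)%N ->
    (i * nth 0 (kcols K) k = j * nth 0 (krows K) k)%N ->
    (i' * nth 0 (kcols K) k' = j' * nth 0 (krows K) k')%N ->
    (offset (krows K) k + i <= offset (krows K) k' + i')%N
      && (offset (kcols K) k + j <= offset (kcols K) k' + j')%N.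
  case=> [k [i [j [lt_k le_i le_j ij ->]]]] [k' [i' [j' [lt_k' le_i' le_j' ij' ->]]]].
  have [lt_kk' | lt_k'k | kk'] := ltngtP k k'.
  - by left; apply: mono => //; rewrite lt_kk' lt_k'.
  - by right; apply: mono => //; rewrite lt_k'k lt_k.
  - case/orP: (leq_total i i') => le_ii'; [left | right]; apply: mono => //.
      by rewrite kk' eqxx le_ii' lt_k' orbT.
    by rewrite kk' eqxx le_ii' lt_k' orbT.
case/orP=> [/andP[lt_kk' lt_k'] | /andP[/andP[/eqP <- le_ii'] lt_k]] le_i le_j ij ij'.
  have := leq_offset (krows K) lt_kk'; have := leq_offset (kcols K) lt_kk'.
  by rewrite !offsetS; lia.
have [] := block_size_cases K_canonical lt_k; rewrite -nth_krows => r_gt0 _ _.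
rewrite !leq_add2l le_ii' /= -(leq_pmul2r r_gt0) -ij -ij'.
by rewrite leq_mul2r le_ii' orbT.
Qed.

(** * Zero corners of the canonical form *)

(** The lower left corner meets the diagonal blocks only in a corner of [B]. The list is a variable
    with an equation since the type of the matrix depends on it. *)
Lemma block_diag0 (B : Defs.pblock F) s1 s2 a b :
  (a <= brows B)%N -> (b <= bcols B)%N ->
  (forall (i : 'I_(brows B)) (j : 'I_(bcols B)),
     (a <= i)%N -> (j < b)%N -> bmx B i j = 0) ->
  forall s (eq_s : s = s1 ++ B :: s2)
    (i : 'I_(sumn [seq brows B | B <- s])) (j : 'I_(sumn [seq bcols B | B <- s])),
  (sumn [seq brows B | B <- s1] + a <= i)%N ->
  (j < sumn [seq bcols B | B <- s1] + b)%N -> block_diag s i j = 0.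
Proof.
move=> le_a le_b B0 s ->; elim: s1 => [|B1 s1 IHs] /= i j.
  rewrite !add0n => le_ai lt_jb; rewrite mxE; case: splitP => i' i'E; rewrite mxE.
    case: splitP => j' j'E; last by rewrite mxE.
    by apply: B0; rewrite -?i'E -?j'E.
  case: splitP => j' j'E; first by rewrite mxE.
  by move: lt_jb; rewrite j'E; lia.
move=> le_i lt_j; rewrite mxE; case: splitP => i' i'E; rewrite mxE.
  by have := ltn_ord i'; move: le_i; rewrite i'E; lia.
case: splitP => j' j'E; first by rewrite mxE.
apply: IHs; first by move: le_i; rewrite i'E; lia.
by move: lt_j; rewrite j'E; lia.
Qed.

Lemma kmx_vertex0 k (i : 'I_(sumn (krows K))) (j : 'I_(sumn (kcols K))) :
  (offset (krows K) k <= i)%N -> (j < offset (kcols K) k)%N -> kmx K i j = 0.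
Proof.
have [lt_k | le_k] := ltnP k (nblocks K); last first.
  by rewrite offset_size ?size_map // leqNgt ltn_ord.
(* A default value for [nth], never reached since [k < nblocks K]. *)
pose B0 : Defs.pblock F := @PBlock F 0 0 0.
have := cat_take_drop k (kblocks K); rewrite (drop_nth B0) // => /esym Ks.
rewrite /offset /krows /kcols -!map_take => le_i lt_j.
by apply: (block_diag0 (leq0n _) (leq0n _) _ Ks); rewrite ?addn0.
Qed.

(** A corner at a vertex avoids all diagonal blocks. A corner inside the regular block meets it in
    rows [>= b] and columns [< b], below the diagonal. *)
Lemma kmx_boundary0 p : (0 < nblocks K)%N ->
  upper_triangular (pencil (kC K) (kD K)) -> boundary p ->
  forall (i : 'I_(sumn (krows K))) (j : 'I_(sumn (kcols K))),
  (p.1 <= i)%N -> (j < p.2)%N -> kmx K i j = 0.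
Proof.
move=> nb_gt0 /is_trig_mxP triK /boundaryP -/(_ nb_gt0)[[k _ ->] | [b b_ks ->]] i j.
  exact: kmx_vertex0.
have ks_gt0 : (0 < ksize K)%N by lia.
have [s Ks] := regular_block ks_gt0.
have le_b : (b <= ksize K)%N by lia.
have -> : offset (krows K) (size (keps K))
    = sumn [seq brows B | B <- [seq PBlock (Lmx F e) | e <- keps K]].
  by rewrite /offset /krows Ks map_cat take_size_cat ?size_map.
have -> : offset (kcols K) (size (keps K))
    = sumn [seq bcols B | B <- [seq PBlock (Lmx F e) | e <- keps K]].
  by rewrite /offset /kcols Ks map_cat take_size_cat ?size_map.
apply: (block_diag0 (B := PBlock (pencil (kC K) (kD K))) le_b le_b _ Ks).
by move=> i' j' le_bi lt_jb; have := triK j' i' (leq_trans lt_jb le_bi); rewrite mxE.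
Qed.

End Boundary.
(** * The DM-flag *)

Lemma conj_mx_mul_adjoint (C : numClosedFieldType) m q (h : 'M[C]_m) (W : 'M[C]_(q, m)) :
  h^t* *m (map_mx Num.conj W)^T = (W *m h)^t*.
Proof. by rewrite trmx_mul map_mxM map_trmx. Qed.

Lemma sesquilinear_mxE (C : numClosedFieldType) p q n m (U : 'M[C]_(p, n))
    (A : 'M[C]_(n, m)) (V : 'M[C]_(q, m)) x y :
  (U *m A *m V^t*) x y = (row x U *m A *m (row y V)^t*) 0 0.
Proof.
rewrite -row_mul mxE [RHS]mxE; apply: eq_bigr => j _.
by rewrite [row _ _ _ _]mxE; congr (_ * _); rewrite !mxE.
Qed.

(** Destructing the size equalities turns the cast into the identity. *)
Lemma weighted_rank_castmx (F : fieldType) a b (s : seq (Defs.pblock F)) n m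
    (en : sumn [seq brows B | B <- s] = n) (em : sumn [seq bcols B | B <- s] = m)
    p q (X : 'M[F]_(p, n)) (Y : 'M[F]_(q, m)) :
  foldr (fun B => and (stable_block B)) True s ->
  annihilates (castmx (en, em) (block_diag s)) X Y ->
  (a * \rank X + b * \rank Y
     <= \sum_(B <- s) maxn (a * brows B) (b * bcols B))%N.
Proof.
case: n / en X; case: m / em Y => Y X.
by rewrite castmx_id => /weighted_rank_block_diag; apply.
Qed.

(** The maximum is the [b] term before [k] and the [a] term from [k] on. Adding [a] times the offset
    avoids subtraction. *)
Lemma sum_maxn_threshold a b (s : seq (nat * nat)) k :
  (forall l, (l < k)%N -> (l < size s)%N ->
    a * (nth (0, 0) s l).1 <= b * (nth (0, 0) s l).2)%N ->
  (forall l, (k <= l)%N -> (l < size s)%N ->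
    b * (nth (0, 0) s l).2 <= a * (nth (0, 0) s l).1)%N ->
  (\sum_(p <- s) maxn (a * p.1) (b * p.2) + a * offset (unzip1 s) k
    = a * sumn (unzip1 s) + b * offset (unzip2 s) k)%N.
Proof.
elim: s k => [|p s IHs] k below above.
  by rewrite big_nil !offset_size //= !muln0.
rewrite big_cons; case: k below above => [|k] below above.
  have := IHs 0%N; rewrite !offset0 !muln0 !addn0 => IH0.
  rewrite IH0 // => [|l _]; last exact: above l.+1 isT.
  by rewrite /= (maxn_idPl (above 0%N isT isT)) mulnDr.
have := IHs k (fun l => below l.+1) (fun l => above l.+1).
by rewrite (maxn_idPr (below 0%N isT isT)) /offset /= !mulnDr; lia.
Qed.

Section Flag.
Variables (R : realType) (n m : nat) (A1 A2 : 'M[R[i]]_(n, m)).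
Variables (g : 'M[R[i]]_n) (h : 'M[R[i]]_m) (K : kronecker R[i]).
Hypotheses (n_gt0 : (0 < n)%N) (m_gt0 : (0 < m)%N).
Hypotheses (g_unit : g \in unitmx) (h_unit : h \in unitmx).
Hypothesis K_canonical : is_canonical K.
Hypotheses (rowsK : sumn (krows K) = n) (colsK : sumn (kcols K) = m).
Hypothesis ghK : map_mx polyC g *m pencil A1 A2 *m map_mx polyC (h ^t*)
  = castmx (rowsK, colsK) (kmx K).

Local Notation "'S_A'" := (vanishing_pairs A1 A2).
Local Notation "'C_A'" := (convex_hull (@dimpair R n m @` vanishing_pairs A1 A2)).
Local Notation rows := (nth 0%N (krows K)).
Local Notation cols := (nth 0%N (kcols K)).
Local Notation roff := (offset (krows K)).
Local Notation coff := (offset (kcols K)).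

Let nblocks_gt0 : (0 < nblocks K)%N.
Proof.
rewrite /nblocks; case Ks: (kblocks K) => //.
by move: n_gt0; rewrite -rowsK /krows Ks.
Qed.

Let rows_gt0 k : (k < nblocks K)%N -> (0 < rows k)%N.
Proof. by case/(block_size_cases K_canonical); rewrite nth_krows. Qed.

Let cols_gt0 k : (k < nblocks K)%N -> (0 < cols k)%N.
Proof. by case/(block_size_cases K_canonical); rewrite nth_kcols. Qed.

Let roff_le k : (roff k <= n)%N.
Proof. by rewrite -rowsK offset_le_sumn. Qed.

Let coff_le k : (coff k <= m)%N.
Proof. by rewrite -colsK offset_le_sumn. Qed.

(** * Vanishing pairs in canonical coordinates *)

Lemma annihilates_kmx p q (U : 'M[R[i]]_(p, n)) (V : 'M[R[i]]_(q, m)) :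
  annihilates (castmx (rowsK, colsK) (kmx K))
    (U *m invmx g) (map_mx Num.conj (V *m invmx h)) <->
  U *m A1 *m V^t* = 0 /\ U *m A2 *m V^t* = 0.
Proof.
rewrite -ghK mul_pencil annihilates_pencil !mulmxA !mulmxKV //.
by rewrite -!(mulmxA _ (h^t*)) !conj_mx_mul_adjoint mulmxKV.
Qed.

(** In each term of the double sum a factor vanishes: the coordinate of [u] if [i < a], that of [v]
    if [j >= b], and otherwise the entry of the canonical form. *)
Lemma vanishing_spans a b :
  (forall (i : 'I_(sumn (krows K))) (j : 'I_(sumn (kcols K))),
    (a <= i)%N -> (j < b)%N -> kmx K i j = 0) ->
  S_A (tail_span g a, head_span h b).
Proof.
move=> K0 u v /= u_a v_b; apply/annihilates_kmx/matrixP=> x y.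
rewrite mxE [RHS]mxE big1 // => j _; rewrite mxE big_distrl big1 //= => i _.
rewrite castmxE /= [map_mx polyC (u *m _) _ _]mxE.
rewrite [(map_mx _ (map_mx _ _))^T _ _]mxE [map_mx _ (map_mx _ _) _ _]mxE.
rewrite [map_mx Num.conj _ _ _]mxE.
have [le_ai | lt_ia] := leqP a i; last first.
  have -> : (u *m invmx g) x i = 0; last by rewrite polyC0 !mul0r.
  by rewrite ord1 (row_span_coord g_unit u_a) // finset.in_set -ltnNge.
have [lt_jb | le_bj] := ltnP j b; first by rewrite K0 // mulr0 mul0r.
have -> : (v *m invmx h) y j = 0; last by rewrite conjC0 polyC0 mulr0.
by rewrite ord1 (row_span_coord h_unit v_b) // finset.in_set -leqNgt.
Qed.

Lemma stable_kblocks : foldr (fun B => and (stable_block B)) True (kblocks K).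
Proof.
case: K_canonical => eps_gt0 _ eta_gt0 _ regK.
have cat_stable s s' : foldr (fun B => and (@stable_block R[i] B)) True s ->
    foldr (fun B => and (stable_block B)) True s' ->
    foldr (fun B => and (stable_block B)) True (s ++ s').
  by elim: s => //= B s IHs [sB /IHs{}IHs] /IHs.
rewrite /kblocks; apply: (cat_stable).
  elim: (keps K) eps_gt0 => //= e s IHs /andP[e_gt0 /IHs{}IHs]; split=> //.
  by split=> //; apply: semistable_Lmx.
apply: (cat_stable).
  case: ifP => //= ks_gt0; split=> //; split=> //.
  exact: semistable_regular.
rewrite -all_rev in eta_gt0.
elim: (rev _) eta_gt0 => //= e s IHs /andP[e_gt0 /IHs{}IHs]; split=> //.
by split=> //; apply/semistable_tr/semistable_Lmx.
Qed.

(** The block bound is applied to bases in canonical coordinates; invertible factors and conjugation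
    preserve ranks. *)
Lemma vanishing_weight P a b : S_A P ->
  (a * \dim P.1 + b * \dim P.2
    <= \sum_(p <- block_sizes K) maxn (a * p.1) (b * p.2))%N.
Proof.
move=> SP; have XY : annihilates (castmx (rowsK, colsK) (kmx K))
    (vmx P.1 *m invmx g) (map_mx Num.conj (vmx P.2 *m invmx h)).
  apply/annihilates_kmx; split; apply/matrixP=> x y;
    have [uA1v uA2v] := SP _ _ (row_vmx_mem x) (row_vmx_mem y).
    by rewrite sesquilinear_mxE uA1v !mxE.
  by rewrite sesquilinear_mxE uA2v !mxE.
rewrite big_map -(rank_vmx P.1) -(rank_vmx P.2).
rewrite -(mxrankMfree (vmx P.1) (B := invmx g)) ?row_free_unit ?unitmx_inv //.
rewrite -(mxrankMfree (vmx P.2) (B := invmx h)) ?row_free_unit ?unitmx_inv //.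
rewrite -(mxrank_map Num.conj (vmx P.2 *m _)).
exact: weighted_rank_castmx stable_kblocks XY.
Qed.

(** * Supporting lines of the polygonal line *)

(** The functional [a x + b y] changes by [b cols l - a rows l] along edge [l]. So it does not
    decrease before vertex [k] nor increase after it, and is maximal there among the vertices. *)
Definition threshold a b k : Prop :=
  (forall l, (l < k)%N -> (l < nblocks K)%N -> (a * rows l <= b * cols l)%N) /\
  (forall l, (k <= l)%N -> (l < nblocks K)%N -> (b * cols l <= a * rows l)%N).

Lemma vanishing_vertex_bound P a b k : S_A P -> threshold a b k ->
  (a * \dim P.1 + b * \dim P.2 + a * roff k <= a * n + b * coff k)%N.
Proof.
move=> SP [below above].
have := @sum_maxn_threshold a b (block_sizes K) k.
have -> : unzip1 (block_sizes K) = krows K by rewrite /unzip1 -map_comp.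
have -> : unzip2 (block_sizes K) = kcols K by rewrite /unzip2 -map_comp.
rewrite size_block_sizes rowsK => sumE.
rewrite -sumE ?leq_add2r ?vanishing_weight // => l lt_l;
  by rewrite -nth_krows -nth_kcols; auto.
Qed.

(** [(cols k, rows k)] is normal to edge [k], and monotone slopes make it maximal at both ends of
    that edge. *)
Lemma threshold_edge k l : (k < nblocks K)%N -> (k <= l <= k.+1)%N ->
  threshold (cols k) (rows k) l.
Proof.
move=> lt_k k_l.
have slope i j : (i <= j)%N -> (j < nblocks K)%N ->
    (cols j * rows i <= cols i * rows j)%N.
  rewrite leq_eqVlt => /predU1P[-> | lt_ij] lt_j //.
  by have := block_slopes K_canonical lt_ij lt_j; rewrite !nth_krows !nth_kcols.
split=> i lt_i lt_ib.
  by rewrite [leqRHS]mulnC slope //; lia.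
by rewrite mulnC slope //; lia.
Qed.

Definition vertex k : sspair R n m := (tail_span g (roff k), head_span h (coff k)).

Lemma vanishing_vertex k : S_A (vertex k).
Proof. by apply: vanishing_spans => i j; apply: kmx_vertex0. Qed.

Lemma dimpair_spans a b : (a <= n)%N -> (b <= m)%N ->
  dimpair (tail_span g a, head_span h b) = (n%:R - a%:R, b%:R) :> R^o * R^o.
Proof.
by move=> le_a le_b; rewrite /dimpair /= dim_tail_span ?dim_head_span ?natrB.
Qed.

Lemma dimpair_vertex k :
  dimpair (vertex k) = (n%:R - (roff k)%:R, (coff k)%:R) :> R^o * R^o.
Proof. exact: dimpair_spans. Qed.

Lemma conv_pairE (t : R) (p q : R^o * R^o) :
  t *: p + (1 - t) *: q =
  (t * p.1 + (1 - t) * q.1, t * p.2 + (1 - t) * q.2).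
Proof. by []. Qed.

Lemma extreme_point_threshold a b a' b' k :
  threshold a b k -> threshold a' b' k -> (a * b' != a' * b)%N ->
  extreme_point C_A (dimpair (vertex k)).
Proof.
have bound c d : threshold c d k -> forall z, (@dimpair R n m @` S_A) z ->
    c%:R * z.1 + d%:R * z.2
      <= c%:R * (dimpair (vertex k)).1 + d%:R * (dimpair (vertex k)).2 :> R.
  move=> cd _ [P SP <-]; have := vanishing_vertex_bound SP cd.
  rewrite dimpair_vertex /dimpair /= -(ler_nat R) !natrD !natrM; lra.
move=> /bound bd /bound bd' indep.
apply: (extreme_point_vertex _ _ bd bd').
  by rewrite -!natrM eqr_nat.
by exists (vertex k) => //; apply: vanishing_vertex.
Qed.

(** Two independent supporting functionals meet at the vertex: the normals of the adjacent edges,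
    with a coordinate functional replacing the missing edge at either end of the line. *)
Lemma extreme_point_gammas k : k \in gammas K n m ->
  extreme_point C_A (dimpair (vertex k)).
Proof.
rewrite (mem_gammas rowsK colsK nblocks_gt0).
case/or3P=> [/eqP-> | /eqP-> | /andP[/andP[k_gt0 lt_k] sizes]].
- apply: (@extreme_point_threshold 1 0 (cols 0) (rows 0)).
  + by split=> l.
  + exact: threshold_edge.
  + by rewrite mul1n muln0 -lt0n rows_gt0.
- have lt_b : ((nblocks K).-1 < nblocks K)%N by rewrite prednK.
  apply: (@extreme_point_threshold 0 1 (cols (nblocks K).-1) (rows (nblocks K).-1)).
  + by split=> l // le_l; rewrite ltnNge le_l.
  + by apply: threshold_edge; rewrite // prednK // leqnn leq_pred.
  + by rewrite mul0n muln1 eq_sym -lt0n cols_gt0.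
have lt_k1 : (k.-1 < nblocks K)%N by rewrite (leq_ltn_trans (leq_pred k)).
apply: (@extreme_point_threshold (cols k.-1) (rows k.-1) (cols k) (rows k)).
- by apply: threshold_edge; rewrite // prednK // leqnn leq_pred.
- by apply: threshold_edge; rewrite // leqnn leqnSn.
apply: contraNneq sizes; rewrite !nth_krows !nth_kcols => e.
by apply/eqP/(block_slope_inj K_canonical).
Qed.

(* (X + X', Y :&: Y') and (X :&: X', Y + Y') also vanish and their dimension
   vectors have the same sum as those of (X, Y) and (X', Y'). *)
Lemma extreme_dimpair_inj P Q : S_A P -> S_A Q ->
  extreme_point C_A (dimpair P) -> dimpair Q = dimpair P -> Q = P.
Proof.
case: P Q => [X Y] [X' Y'] SP SQ [_ extP] eqPQ.
have [/eqP eqX /eqP eqY] : \dim X' = \dim X /\ \dim Y' = \dim Y.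
  by case: eqPQ => /eqP; rewrite eqr_nat => /eqP-> /eqP; rewrite eqr_nat => /eqP->.
have SU : S_A ((X + X')%VS, (Y :&: Y')%VS).
  move=> u v /= /memv_addP[x Xx [x' X'x' ->]]; rewrite memv_cap => /andP[Yv Y'v].
  have [/= xv1 xv2] := SP x v Xx Yv; have [/= x'v1 x'v2] := SQ x' v X'x' Y'v.
  by rewrite !mulmxDl xv1 xv2 x'v1 x'v2 addr0.
have SI : S_A ((X :&: X')%VS, (Y + Y')%VS).
  move=> u v /=; rewrite memv_cap => /andP[Xu X'u] /memv_addP[y Yy [y' Y'y' ->]].
  have [/= uy1 uy2] := SP u y Xu Yy; have [/= uy'1 uy'2] := SQ u y' X'u Y'y'.
  by rewrite linearD /= map_mxD !mulmxDr uy1 uy2 uy'1 uy'2 addr0.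
have dimX := dimv_sum_cap X X'; have dimY := dimv_sum_cap Y Y'.
have [||||] := extP (dimpair ((X + X')%VS, (Y :&: Y')%VS))
  (dimpair ((X :&: X')%VS, (Y + Y')%VS)) 2^-1.
- by apply: sub_convex_hull; exists ((X + X')%VS, (Y :&: Y')%VS).
- by apply: sub_convex_hull; exists ((X :&: X')%VS, (Y + Y')%VS).
- by apply/andP; split; lra.
- have dimX_R := congr1 (fun k => k%:R : R) dimX.
  have dimY_R := congr1 (fun k => k%:R : R) dimY.
  move: dimX_R dimY_R; rewrite !natrD (eqP eqX) (eqP eqY) => dimX_R dimY_R.
  by rewrite conv_pairE /dimpair /=; congr (_, _); lra.
(* Extremality gives [X + X'] the dimension of [X] and [Y :&: Y'] that of [Y]. Thus [X'] lies in [X]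
   and [Y] in [Y'], and equal dimensions finish. *)
case=> /eqP; rewrite eqr_nat => dimXX' /eqP; rewrite eqr_nat => dimYY'.
move=> _; congr (_, _); apply/eqP.
  have eqXX' : (X == X + X')%VS by rewrite eqEdim addvSl (eqP dimXX') leqnn.
  by rewrite eqEdim (eqP eqX) leqnn andbT (eqP eqXX') addvSr.
have eqYY' : (Y :&: Y' == Y)%VS by rewrite eqEdim capvSl (eqP dimYY') leqnn.
by rewrite eq_sym eqEdim (eqP eqY) leqnn andbT -(eqP eqYY') capvSr.
Qed.

(** * The coarse flag *)

Lemma dimpair_vertex0 : dimpair (vertex 0) = (n%:R, 0) :> R^o * R^o.
Proof. by rewrite dimpair_vertex !offset0 subr0. Qed.

Lemma vanishing_le P X Y : S_A P -> (X <= P.1)%VS -> (Y <= P.2)%VS -> S_A (X, Y).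
Proof. by move=> SP XP YP u v /= /(subvP XP)Pu /(subvP YP)Pv; apply: SP. Qed.

(** Any other point is inside a segment of the hull: on the horizontal axis between [(0, 0)] and
    [(n, 0)], strictly below the polygonal line on a vertical segment, or on an edge between its
    ends. *)
Lemma coarse_DM_flag_vertex P : coarse_DM_flag A1 A2 P ->
  exists2 k, (k <= nblocks K)%N & dimpair P = dimpair (vertex k).
Proof.
case=> SP [_ extP] P_neq0.
have hull Q : S_A Q -> C_A (dimpair Q) by move=> SQ; apply: sub_convex_hull; exists Q.
have xhull : C_A ((\dim P.1)%:R, 0).
  have := hull _ (vanishing_le SP (subvv _) (sub0v _)).
  by rewrite /dimpair /= dimv0.
have hull0 : C_A (0, 0).
  by have := hull _ (vanishing_le SP (sub0v _) (sub0v _)); rewrite /dimpair /= !dimv0.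
have hullv k : C_A (dimpair (vertex k)) by exact: hull (@vanishing_vertex k).
have hulln : C_A (n%:R, 0) by rewrite -dimpair_vertex0; apply: hullv.
have le_xn : (\dim P.1 <= n)%N by rewrite -(rank_vmx P.1) rank_leq_col.
have n_neq0 : n%:R != 0 :> R by rewrite pnatr_eq0 -lt0n.
have [y0 | y_gt0] := posnP (\dim P.2).
  have [x0 | x_gt0] := posnP (\dim P.1).
    by case: P_neq0; rewrite /dimpair x0 y0.
  exists 0%N => //; rewrite dimpair_vertex0 /dimpair y0.
  have [-> // | ne_xn] := eqVneq (\dim P.1) n.
  have [||||] := extP (n%:R, 0) (0, 0) ((\dim P.1)%:R / n%:R) => //.
  - by rewrite divr_gt0 ?ltr0n // ltr_pdivrMr ?ltr0n // mul1r ltr_nat ltn_neqAle ne_xn.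
  - by rewrite conv_pairE /dimpair y0 /= !mulr0 !addr0 divfK.
  by case=> /eqP; rewrite eqr_nat eq_sym (negPf ne_xn).
(* Edge [k] lies over the abscissa [dim P.1], at parameter [t]; [y] is the height of the line
   there. *)
have [k lt_k /andP[le_k le_k1]] := offset_between (d := n - \dim P.1)
  (s := krows K) (etrans (congr1 (leq 1) (size_map _ _)) nblocks_gt0)
  (leq_trans (leq_subr _ _) (eq_leq (esym rowsK))).
rewrite size_map -/(nblocks K) in lt_k.
pose t : R := (n - \dim P.1 - roff k)%:R / (rows k)%:R.
have r_gt0 : 0 < (rows k)%:R :> R by rewrite ltr0n rows_gt0.
have tE : t * (rows k)%:R = n%:R - (\dim P.1)%:R - (roff k)%:R.
  by rewrite /t divfK ?gt_eqF // !natrB.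
have t_ge0 : 0 <= t by rewrite divr_ge0.
have t_le1 : t <= 1.
  by rewrite ler_pdivrMr // mul1r ler_nat leq_subLR -offsetS.
pose y : R := (coff k)%:R + t * (cols k)%:R.
have wE : ((\dim P.1)%:R, y)
    = t *: dimpair (vertex k.+1) + (1 - t) *: dimpair (vertex k) :> R^o * R^o.
  rewrite conv_pairE !dimpair_vertex !offsetS !natrD; congr (_, _) => /=.
    by apply/eqP; rewrite -subr_eq0; apply/eqP; move: tE; lra.
  by rewrite /y; ring.
have le_y : (\dim P.2)%:R <= y.
  have := vanishing_vertex_bound SP (threshold_edge (l := k) lt_k _).
  rewrite leqnn leqnSn => /(_ isT); rewrite -(ler_nat R) !natrD !natrM => bound.
  rewrite -(ler_pM2l r_gt0) /y mulrDr mulrCA mulrA tE.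
  by move: bound; lra.
have [yE | ne_y] := eqVneq (\dim P.2)%:R y; last first.
  have lt_y : (\dim P.2)%:R < y by rewrite lt_neqAle ne_y.
  have y_gt0' : 0 < y by apply: le_lt_trans lt_y.
  have [||||] := extP ((\dim P.1)%:R, y) ((\dim P.1)%:R, 0) ((\dim P.2)%:R / y) => //.
  - by rewrite wE; apply: convex_hull_conv; rewrite ?t_ge0 ?t_le1 //; apply: hullv.
  - by rewrite divr_gt0 ?ltr0n // ltr_pdivrMr // mul1r.
  - rewrite conv_pairE /dimpair /= mulr0 addr0 divfK ?gt_eqF //.
    by congr (_, _); ring.
  by case=> eq_y; rewrite eq_y eqxx in ne_y.
have PE : dimpair P = t *: dimpair (vertex k.+1) + (1 - t) *: dimpair (vertex k).
  by rewrite -wE /dimpair yE.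
have [t0 | t_neq0] := eqVneq t 0.
  exists k; first exact: ltnW.
  by rewrite PE t0 scale0r add0r subr0 scale1r.
have [t1 | t_neq1] := eqVneq t 1.
  exists k.+1; first exact: lt_k.
  by rewrite PE t1 subrr scale1r scale0r addr0.
exists k; first exact: ltnW.
have t01 : 0 < t < 1 by rewrite !lt_neqAle eq_sym t_neq0 t_neq1 t_ge0.
by have [_ ->] := extP _ _ t (hullv k.+1) (hullv k) t01 PE.
Qed.

(** Between two blocks of equal size, a vertex is the midpoint of its two neighbours. *)
Lemma gammas_extreme k : (k <= nblocks K)%N ->
  extreme_point C_A (dimpair (vertex k)) -> k \in gammas K n m.
Proof.
rewrite leq_eqVlt (mem_gammas rowsK colsK nblocks_gt0) => /predU1P[-> | lt_k].
  by rewrite eqxx orbT.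
case: k lt_k => [//|k] lt_k [_ extk]; apply/or3P/Or33; rewrite lt_k /=.
apply/eqP=> sizes.
have hull l : C_A (dimpair (vertex l)).
  by apply: sub_convex_hull; exists (vertex l) => //; apply: vanishing_vertex.
have [||||] := extk (dimpair (vertex k)) (dimpair (vertex k.+2)) 2^-1 => //.
- by apply/andP; split; lra.
- rewrite conv_pairE !dimpair_vertex !offsetS !nth_krows !nth_kcols sizes !natrD.
  by congr (_, _) => /=; lra.
move=> + _; rewrite !dimpair_vertex offsetS => -[+ _]; rewrite natrD.
have : 0 < (rows k)%:R :> R by rewrite ltr0n rows_gt0 // ltnW.
lra.
Qed.

Lemma coarse_DM_flagE :
  coarse_DM_flag A1 A2 = [set vertex k | k in [set` gammas K n m]].
Proof.
apply/seteqP; split=> [P coarseP | _ [k /= gk <-]].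
  have [k le_k PE] := coarse_DM_flag_vertex coarseP.
  case: coarseP => SP extP _; exists k; first by apply: gammas_extreme; rewrite -?PE.
  exact: (extreme_dimpair_inj SP (@vanishing_vertex k) extP (esym PE)).
split; [exact: vanishing_vertex | exact: extreme_point_gammas |].
(* No vertex is the origin: vertex 0 has first coordinate [n > 0], and a later one has second
   coordinate at least [cols 0 > 0]. *)
rewrite dimpair_vertex => -[/eqP]; rewrite subr_eq0 eqr_nat => /eqP n_k.
case: k gk n_k => [|k] _; first by rewrite offset0 => n0; move: n_gt0; rewrite n0.
move=> _ /eqP; rewrite pnatr_eq0 => /eqP c0.
have := leq_offset (kcols K) (ltn0Sn k); rewrite c0 offsetS offset0 add0n.
by rewrite leqNgt cols_gt0.
Qed.

(** * The refined flag *)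

Definition span_pair (p : nat * nat) : sspair R n m :=
  (tail_span g p.1, head_span h p.2).

Lemma flag_boundary :
  [set (Xsp K g k, Ysp K h k) | k in [set k | (k <= nblocks K)%N]]
    `|` [set (Xcsp K g b, Ycsp K h b) | b in [set b | (1 <= b <= (ksize K).-1)%N]]
  = span_pair @` boundary K.
Proof.
apply/seteqP; split=> [P [[k /= le_k <-] | [b /= b_ks <-]] | _ [p bp <-]].
- exists (roff k, coff k); last by rewrite XspE // YspE.
  by apply/(boundaryP K_canonical _ nblocks_gt0); left; exists k.
- have [ks_gt0 le_b] : (0 < ksize K)%N /\ (b <= ksize K)%N by lia.
  exists (roff (size (keps K)) + b, coff (size (keps K)) + b)%N.
    by apply/(boundaryP K_canonical _ nblocks_gt0); right; exists b.
  by rewrite XcspE // YcspE.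
case/(boundaryP K_canonical _ nblocks_gt0): bp => [[k le_k ->] | [b b_ks ->]].
  by left; exists k; rewrite // XspE // YspE.
have [ks_gt0 le_b] : (0 < ksize K)%N /\ (b <= ksize K)%N by lia.
by right; exists b; rewrite // XcspE // YcspE.
Qed.

Lemma boundary_le p : boundary K p -> (p.1 <= n)%N /\ (p.2 <= m)%N.
Proof.
case=> k [i [j [_ le_i le_j _ ->]]]; have := roff_le k.+1; have := coff_le k.+1.
by rewrite !offsetS /=; lia.
Qed.

Lemma dm_le_dim_eq (P Q : sspair R n m) :
  dm_le P Q -> dimpair P = dimpair Q -> P = Q.
Proof.
case: P Q => [X Y] [X' Y'] [/= leX leY] [/eqP + /eqP].
rewrite !eqr_nat => /eqP dimX /eqP dimY; congr (_, _); apply/eqP.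
  by rewrite eq_sym eqEdim leX dimX leqnn.
by rewrite eqEdim leY dimY leqnn.
Qed.

Lemma dm_le_span_pair p q :
  (p.1 <= q.1)%N && (p.2 <= q.2)%N -> dm_le (span_pair p) (span_pair q).
Proof. by case/andP=> le1 le2; split; [apply: tail_spanS | apply: head_spanS]. Qed.

Local Notation gam := (nth 0%N (gammas K n m)).
Local Notation ngam := (size (gammas K n m)).

Lemma offset_gammas a k : (a.+1 < ngam)%N -> (gam a <= k <= gam a.+1)%N ->
  (roff k = roff (gam a) + (k - gam a) * rows (gam a) /\
   coff k = coff (gam a) + (k - gam a) * cols (gam a))%N.
Proof.
move=> lt_a /andP[le_ak le_ka].
have sizes := block_sizes_gammas rowsK colsK nblocks_gt0 lt_a.
split; apply: offset_const => // l /andP[le_l lt_l].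
  by rewrite !nth_krows sizes // le_l (leq_trans lt_l).
by rewrite !nth_kcols sizes // le_l (leq_trans lt_l).
Qed.

Lemma gammas_lt a : (a.+1 < ngam)%N -> (gam a < gam a.+1)%N.
Proof. exact: nth_gammas_lt. Qed.

Lemma gammas_lt_nblocks a : (a.+1 < ngam)%N -> (gam a < nblocks K)%N.
Proof.
move=> lt_a; apply: leq_trans (gammas_lt lt_a) _.
exact: gammas_le.
Qed.

(** The segment consists of [N] equal edges with steps [(r, c)]. The displacement [(e, f)] from its
    start satisfies [e c = f r]; dividing [e] by [r] gives the edge and the position on it. *)
Lemma segment_boundary a Q : (a.+1 < ngam)%N ->
  segment_lattice A1 A2 (vertex (gam a)) (vertex (gam a.+1)) Q ->
  exists2 p, boundary K p & dimpair Q = dimpair (span_pair p).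
Proof.
move=> lt_a [SQ [t /andP[t_ge0 t_le1]]].
have lt_g := gammas_lt lt_a; have lt_gb := gammas_lt_nblocks lt_a.
have [rE cE] := offset_gammas (k := gam a.+1) lt_a
  (introT andP (conj (ltnW lt_g) (leqnn _))).
have r_gt0 := rows_gt0 lt_gb; have c_gt0 := cols_gt0 lt_gb.
have le_xn : (\dim Q.1 <= n)%N by rewrite -(rank_vmx Q.1) rank_leq_col.
rewrite !dimpair_vertex => QE0.
have xE : (\dim Q.1)%:R = (1 - t) * (n%:R - (roff (gam a))%:R)
    + t * (n%:R - (roff (gam a.+1))%:R) := congr1 fst QE0.
have yE : (\dim Q.2)%:R = (1 - t) * (coff (gam a))%:R
    + t * (coff (gam a.+1))%:R := congr1 snd QE0.
set N := (gam a.+1 - gam a)%N in rE cE; set r := rows _ in rE r_gt0.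
set c := cols _ in cE c_gt0.
have N_gt0 : (0 < N)%N by rewrite subn_gt0.
have xE' : (n - \dim Q.1)%:R = (roff (gam a))%:R + t * (N * r)%:R :> R.
  by rewrite natrB // xE rE natrD; ring.
have yE' : (\dim Q.2)%:R = (coff (gam a))%:R + t * (N * c)%:R :> R.
  by rewrite yE cE natrD; ring.
have le_rd : (roff (gam a) <= n - \dim Q.1)%N.
  by rewrite -(ler_nat R) xE' lerDl mulr_ge0.
have le_dr : (n - \dim Q.1 <= roff (gam a) + N * r)%N.
  by rewrite -(ler_nat R) xE' natrD lerD2l ler_piMl.
have le_cy : (coff (gam a) <= \dim Q.2)%N.
  by rewrite -(ler_nat R) yE' lerDl mulr_ge0.
set e := (n - \dim Q.1 - roff (gam a))%N.
set f := (\dim Q.2 - coff (gam a))%N.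
have eR : e%:R = t * (N * r)%:R :> R by rewrite natrB // xE' addrC addKr.
have fR : f%:R = t * (N * c)%:R :> R by rewrite natrB // yE' addrC addKr.
have ef : (e * c = f * r)%N.
  by apply/eqP; rewrite -(eqr_nat R) !natrM eR fR !natrM; apply/eqP; ring.
have le_e : (e <= N * r)%N by rewrite leq_subLR.
have QE : dimpair Q = dimpair (span_pair (roff (gam a) + e, coff (gam a) + f)%N).
  rewrite /e /f !subnKC // /span_pair dimpair_spans ?leq_subr //.
    by rewrite natrB // subKr.
  by rewrite -(rank_vmx Q.2) rank_leq_col.
exists (roff (gam a) + e, coff (gam a) + f)%N; last exact: QE.
(* The end of the segment is treated apart, as the quotient would be [N], outside the segment. *)
have [lt_e | ge_e] := ltnP e (N * r).
  have lt_q : (e %/ r < N)%N by rewrite ltn_divLR.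
  set q := (e %/ r)%N in lt_q; set k := (gam a + q)%N.
  have lt_k : (k < gam a.+1)%N by rewrite -ltn_subRL.
  have le_k : (gam a <= k)%N by exact: leq_addr.
  have [rk ck] := offset_gammas (k := k) lt_a (introT andP (conj le_k (ltnW lt_k))).
  rewrite addKn in rk ck.
  have sizes := block_sizes_gammas rowsK colsK nblocks_gt0 lt_a
    (introT andP (conj le_k lt_k)).
  have eE : e = (q * r + e %% r)%N by exact: divn_eq.
  have lt_i : (e %% r < r)%N by rewrite ltn_pmod.
  set i := (e %% r)%N in eE lt_i.
  have le_qcf : (q * c <= f)%N.
    by rewrite -(leq_pmul2r r_gt0) -/r -ef eE; nia.
  have ij : (i * c = (f - q * c) * r)%N.
    by rewrite mulnBl -ef eE mulnDl; lia.
  have le_j : (f - q * c <= c)%N.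
    by rewrite -(leq_pmul2r r_gt0) -/r -ij mulnC leq_mul2l ltnW ?orbT.
  exists k, i, (f - q * c)%N; split.
  - exact: leq_trans lt_k (gammas_le rowsK colsK nblocks_gt0 _).
  - by rewrite nth_krows sizes -nth_krows ltnW.
  - by rewrite nth_kcols sizes -nth_kcols.
  - by rewrite nth_krows nth_kcols sizes -nth_krows -nth_kcols.
  - by rewrite rk ck -!addnA -/r -/c -eE subnKC.
have eE : e = (N * r)%N by lia.
have fE : f = (N * c)%N.
  by apply/eqP; rewrite -(eqn_pmul2r r_gt0) -/r -ef eE; lia.
apply/(boundaryP K_canonical _ nblocks_gt0); left; exists (gam a.+1).
  exact: gammas_le.
by rewrite eE fE rE cE.
Qed.

Lemma boundary_segment p : boundary K p -> exists2 a, (a.+1 < ngam)%N &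
  in_segment (dimpair (vertex (gam a))) (dimpair (vertex (gam a.+1)))
    (dimpair (span_pair p)).
Proof.
move=> bp; have [le_p1 le_p2] := boundary_le bp.
rewrite /span_pair dimpair_spans //.
case: bp le_p1 le_p2 => k [i [j [lt_k le_i le_j ij ->]]] /= _ _.
have [a lt_a /andP[le_ak lt_ka]] := gammas_between n m lt_k.
exists a => //; have lt_g := gammas_lt lt_a; have lt_gb := gammas_lt_nblocks lt_a.
rewrite !dimpair_vertex.
have [rE cE] := offset_gammas (k := gam a.+1) lt_a
  (introT andP (conj (ltnW lt_g) (leqnn _))).
have [rk ck] := offset_gammas (k := k) lt_a (introT andP (conj le_ak (ltnW lt_ka))).
have sizes := block_sizes_gammas rowsK colsK nblocks_gt0 lt_a
  (introT andP (conj le_ak lt_ka)).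
move: ij le_i le_j; rewrite nth_krows nth_kcols sizes -nth_krows -nth_kcols.
have r_gt0 := rows_gt0 lt_gb; have c_gt0 := cols_gt0 lt_gb.
set N := (gam a.+1 - gam a)%N in rE cE; set r := rows _ in rE rk r_gt0 *.
set c := cols _ in cE ck c_gt0 *; set q := (k - gam a)%N in rk ck.
move=> ij le_i le_j.
have lt_qN : (q < N)%N by rewrite /q /N; lia.
have Nr_gt0 : 0 < (N * r)%:R :> R by rewrite ltr0n muln_gt0 r_gt0 (leq_trans _ lt_qN).
(* The fraction of the horizontal extent already covered; [i c = j r] makes it the vertical fraction
   too. *)
exists ((q * r + i)%:R / (N * r)%:R).
  rewrite divr_ge0 //= ler_pdivrMr // mul1r ler_nat.
  rewrite (leq_trans (_ : _ <= q.+1 * r)%N) ?leq_mul2r ?lt_qN ?orbT //.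
  by rewrite mulSn addnC leq_add2r.
set t := _ / _.
have tr : t * (N * r)%:R = (q * r + i)%:R by rewrite /t divfK ?gt_eqF.
have tc : t * (N * c)%:R = (q * c + j)%:R.
  have r_neq0 : r%:R != 0 :> R by rewrite pnatr_eq0 -lt0n.
  apply: (mulfI r_neq0); rewrite -natrM mulrCA -natrM.
  have -> : (r * (N * c) = N * r * c)%N by lia.
  by rewrite natrM mulrA tr -natrM; congr (_%:R); lia.
rewrite rk ck rE cE.
have -> : (1 - t) *: ((n%:R - (roff (gam a))%:R, (coff (gam a))%:R) : R^o * R^o)
    + t *: ((n%:R - (roff (gam a) + N * r)%:R, (coff (gam a) + N * c)%:R) : R^o * R^o)
  = ((1 - t) * (n%:R - (roff (gam a))%:R) + t * (n%:R - (roff (gam a) + N * r)%:R),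
     (1 - t) * (coff (gam a))%:R + t * (coff (gam a) + N * c)%:R) by [].
rewrite -!addnA !(natrD _ (roff _)) !(natrD _ (coff _)); congr (_, _).
  by rewrite -tr; ring.
by rewrite -tc; ring.
Qed.

Lemma coarse_chain_vertex : coarse_chain A1 A2 ngam.-1 (fun a => vertex (gam a)).
Proof.
have ngam_gt1 := size_gammas_gt1 K n m.
have ngamE : ngam = ngam.-1.+1 by rewrite prednK // ltnW.
split.
- rewrite coarse_DM_flagE; apply/seteqP; split=> [_ [k /= /(nthP 0%N)[a lt_a <-] <-]|].
    by exists a => //=; rewrite -ltnS -ngamE.
  move=> _ [a /= le_a <-]; exists (gam a) => //=.
  by apply: mem_nth; rewrite ngamE ltnS.
- move=> a; rewrite -ltnS -ngamE => lt_a; have lt_g := gammas_lt lt_a.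
  split.
    by apply: (@dm_le_span_pair (_, _) (_, _)); rewrite !leq_offset // ltnW.
  (* Strictness shows in the second coordinate, as every block has a column. *)
  move/(congr1 (@dimpair R n m)); rewrite !dimpair_vertex => -[_ /eqP].
  rewrite eqr_nat => /eqP cE.
  have := leq_offset (kcols K) lt_g; rewrite -cE offsetS.
  by have := cols_gt0 (gammas_lt_nblocks lt_a); lia.
- rewrite /vertex [gam 0]/= !offset0; congr (_, _).
    apply/eqP; rewrite eqEdim subvf dim_tail_span // subn0 /=.
    by rewrite -(rank_vmx fullv) rank_leq_col.
  by apply/eqP; rewrite -dimv_eq0 dim_head_span.
rewrite (nth_gammas_last K n m) /vertex !offset_size ?size_map // rowsK colsK.
congr (_, _).
  by apply/eqP; rewrite -dimv_eq0 dim_tail_span // subnn.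
apply/eqP; rewrite eqEdim subvf dim_head_span //=.
by rewrite -(rank_vmx fullv) rank_leq_col.
Qed.

(** Each segment receives the flag members in its lattice. A member [Q] of a larger chain has the
    dimension vector of some flag member there; the two are comparable, hence equal. *)
Lemma is_DM_flag_boundary :
  upper_triangular (pencil (kC K) (kD K)) ->
  is_DM_flag A1 A2 (span_pair @` boundary K).
Proof.
move=> triK; have SB p : boundary K p -> S_A (span_pair p).
  move=> bp; apply: vanishing_spans => i j.
  exact: kmx_boundary0 nblocks_gt0 triK bp i j.
have lt_ngam a : (1 <= a <= ngam.-1)%N -> (a.-1.+1 < ngam)%N.
  by have := size_gammas_gt1 K n m; lia.
pose L a := segment_lattice A1 A2 (vertex (gam a.-1)) (vertex (gam a)).
exists ngam.-1, (fun a => vertex (gam a)), (fun a => span_pair @` boundary K `&` L a).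
split; first exact: coarse_chain_vertex.
- move=> a a_ngam; have lt_a := lt_ngam a a_ngam.
  have a_gt0 : a.-1.+1 = a by rewrite prednK //; case/andP: a_ngam.
  split=> [P [] //| P Q [[p bp <-] _] [[q bq <-] _] | M' subM' subL chainM'].
    by have [] := boundary_total K_canonical bp bq => /dm_le_span_pair; [left | right].
  apply/seteqP; split=> // Q M'Q; have LQ := subL _ M'Q.
  have [|p bp dimQ] := segment_boundary (Q := Q) lt_a; first by rewrite a_gt0.
  have Mp : (span_pair @` boundary K `&` L a) (span_pair p).
    split; first by exists p.
    by split; [exact: SB | rewrite -dimQ; case: LQ].
  suff -> : Q = span_pair p by [].
  have [le_Qp | le_pQ] := chainM' _ _ M'Q (subM' _ Mp).
    exact: dm_le_dim_eq le_Qp dimQ.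
  by rewrite (dm_le_dim_eq le_pQ).
apply/seteqP; split=> [_ [p bp <-] | P [a _ []] //].
have [a lt_a segp] := boundary_segment bp; exists a.+1.
  by apply/andP; split; rewrite // -ltnS prednK // (leq_trans _ lt_a).
by split; [exists p | split; [exact: SB | exact: segp]].
Qed.

Lemma coarse_DM_flag_spans :
  [set (Xsp K g k, Ysp K h k) | k in [set` gammas K n m]] = coarse_DM_flag A1 A2.
Proof.
rewrite coarse_DM_flagE; apply: eq_imagel => _ /(nthP 0%N)[a _ <-].
by rewrite YspE XspE // gammas_le.
Qed.

End Flag.

Theorem proposition4p32 (R : realType) (n m : nat) (n_gt0 : (0 < n)%N)
    (m_gt0 : (0 < m)%N) (A1 A2 : 'M[R[i]]_(n, m))
    (kerA : (kerv A1 :&: kerv A2)%VS = 0%VS)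
    (kerAt : (kerv (A1 ^t*) :&: kerv (A2 ^t*))%VS = 0%VS)
    (g : 'M[R[i]]_n) (h : 'M[R[i]]_m)
    (g_unit : g \in unitmx) (h_unit : h \in unitmx)
    (K : kronecker R[i]) (K_canonical : is_canonical K)
    (rowsK : sumn (krows K) = n) (colsK : sumn (kcols K) = m)
    (ghK : map_mx polyC g *m pencil A1 A2 *m map_mx polyC (h ^t*)
           = castmx (rowsK, colsK) (kmx K)) :
  [set (Xsp K g gamma, Ysp K h gamma) | gamma in [set` gammas K n m]]
    = coarse_DM_flag A1 A2
  /\
  (upper_triangular (pencil (kC K) (kD K)) ->
   is_DM_flag A1 A2
     ([set (Xsp K g gamma, Ysp K h gamma) | gamma in
          [set gamma | (gamma <= nblocks K)%N]]
      `|` [set (Xcsp K g beta, Ycsp K h beta) | beta in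
          [set beta | (1 <= beta <= (ksize K).-1)%N]])).
Proof.
split; first exact: coarse_DM_flag_spans ghK.
move=> triK; rewrite flag_boundary //.
exact: is_DM_flag_boundary ghK triK.
Qed.
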